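(* Let $g(n)=\log_2 n-2\log_2\log_2 n+\log_2\log_2 e+c$ with $c$ a real constant. (1) If $c<1$, then $R(g(n),n)\to0$ as $n\to\infty$. (2) If $c>6$, then $R(g(n),n)$ does not tend to 0 as $n\to\infty$. More strongly, for every $\gamma\in[0,1]$ there is a sequence of first-order sentences $\Phi_{n_1},\Phi_{n_2},\dots$ with $n_1<n_2<\cdots$ and $D(\Phi_{n_i})\le g(n_i)$ such that $p_{n_i}(\Phi_{n_i})\to\gamma$ as $i\to\infty$.
   Context: First-order sentences about graphs use variables over vertices, relations $\sim$ (adjacency) and $=$, Boolean connectives, quantifiers; $D(\Phi)$ is the quantifier depth (maximum length of a chain of nested quantifiers). $G_{n,1/2}$ is the random graph on $n$ vertices with each pair adjacent independently with probability $1/2$. For a sentence $\Phi$, $p_n(\Phi)$ is the probability that $\Phi$ is true on $G_{n,1/2}$; by the (known) zero-one law, $p(\Phi)=\lim_{n\to\infty}p_n(\Phi)$ exists and equals 0 or 1. For real $k$ and integer $n$, $R(k,n)=\max\{|p_n(\Phi)-p(\Phi)|:\ \Phi\text{ a sentence with }D(\Phi)\le k\}$. *)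

(* Defs.v *)
From HB Require Import structures.
From mathcomp Require Import all_boot all_order all_algebra.
From mathcomp Require Import all_classical all_reals all_analysis.

Set Implicit Arguments.
Unset Strict Implicit.
Unset Printing Implicit Defensive.

Import Order.TTheory GRing.Theory Num.Theory.
Import numFieldNormedType.Exports.

Local Open Scope classical_set_scope.
Local Open Scope ring_scope.

(* First-order formulas over (~, =) with free variables in 'I_m (well-scoped  *)
(* de Bruijn): under a quantifier the bound variable is ord0 and an outer     *)
(* variable i becomes lift ord0 i.                                            *)
Inductive fo : nat -> Type :=
  | FAdj m of 'I_m & 'I_m : fo m
  | FEq m of 'I_m & 'I_m : fo m
  | FNot m of fo m : fo m
  | FAnd m of fo m & fo m : fo m
  | FOr m of fo m & fo m : fo m
  | FImp m of fo m & fo m : fo m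
  | FEx m of fo m.+1 : fo m
  | FAll m of fo m.+1 : fo m.

Definition sentence : Type := fo 0.

Fixpoint qdepth m (f : fo m) : nat :=
  match f with
  | FAdj _ _ _ | FEq _ _ _ => 0
  | FNot _ f1 => qdepth f1
  | FAnd _ f1 f2 | FOr _ f1 f2 | FImp _ f1 f2 => maxn (qdepth f1) (qdepth f2)
  | FEx _ f1 | FAll _ f1 => (qdepth f1).+1
  end.

Definition env_cons (T : Type) m (x : T) (env : 'I_m -> T) : 'I_m.+1 -> T :=
  fun i => if unlift ord0 i is Some j then env j else x.

Definition env_nil (T : Type) : 'I_0 -> T := fun i => False_rect T (notF (valP i)).

Fixpoint eval (T : finType) (adj : rel T) m (f : fo m) : ('I_m -> T) -> bool :=
  match f in fo m return ('I_m -> T) -> bool with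
  | FAdj _ i j => fun env => adj (env i) (env j)
  | FEq _ i j => fun env => env i == env j
  | FNot _ f1 => fun env => ~~ eval adj f1 env
  | FAnd _ f1 f2 => fun env => eval adj f1 env && eval adj f2 env
  | FOr _ f1 f2 => fun env => eval adj f1 env || eval adj f2 env
  | FImp _ f1 f2 => fun env => eval adj f1 env ==> eval adj f2 env
  | FEx _ f1 => fun env => [exists x, eval adj f1 (env_cons x env)]
  | FAll _ f1 => fun env => [forall x, eval adj f1 (env_cons x env)]
  end.

Definition models (T : finType) (adj : rel T) (Phi : sentence) : bool :=
  eval adj Phi (@env_nil T).

Definition pairs n : {set {set 'I_n}} := [set e : {set 'I_n} | #|e| == 2]%SET.

(* A simple graph on 'I_n is given by its edge set G \subset pairs n; such a  *)
(* G contains no singleton [set x; x], so the relation below is irreflexive.  *)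
Definition adjacent n (G : {set {set 'I_n}}) : rel 'I_n :=
  fun x y => ([set x; y]%SET \in G).

(* The law of G_{n,q}: each pair is independently an edge with probability q. *)
Definition gnq_mass (R : realType) n (q : R) (G : {set {set 'I_n}}) : R :=
  \prod_(e in pairs n) (if e \in G then q else 1 - q).

Definition prob (R : realType) (n : nat) (Phi : sentence) : R :=
  \sum_(G : {set {set 'I_n}} | (G \subset pairs n) && models (adjacent G) Phi)
     gnq_mass 2^-1 G.

Definition limprob (R : realType) (Phi : sentence) : R :=
  lim (prob R n Phi @[n --> \oo]).

Definition dev_set (R : realType) (k : R) (n : nat) : set R :=
  [set `|prob R n Phi - limprob R Phi| | Phi in
     [set Phi : sentence | (qdepth Phi)%:R <= k]].

(* R(k,n). The supremum is a maximum as soon as a sentence of depth at most k *)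
(* exists, i.e. for k >= 1: see dev_max at the end of this file.              *)
Definition dev (R : realType) (k : R) (n : nat) : R := sup (dev_set k n).

Definition log2 (R : realType) (x : R) : R := ln x / ln 2.

Definition g (R : realType) (c : R) (n : nat) : R :=
  log2 n%:R - 2 * log2 (log2 n%:R) + log2 (log2 (expR 1)) + c.

(* Up to logical equivalence there are finitely many formulas of given depth. *)
Lemma fo_finite (d m : nat) :
  exists (S : finType)
         (sem : S -> forall T : finType, rel T -> ('I_m -> T) -> bool),
    forall f : fo m, (qdepth f <= d)%N ->
      exists s, forall (T : finType) (adj : rel T) env,
        eval adj f env = sem s T adj env.
Proof.
have step D k (P : finType)
    (semP : P -> forall T : finType, rel T -> ('I_k -> T) -> bool) :
    (forall f : fo k.+1, (qdepth f < D)%N ->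
      exists s, forall (T : finType) (adj : rel T) env,
        [exists x, eval adj f (env_cons x env)] = semP s T adj env) ->
  exists (S : finType)
         (sem : S -> forall T : finType, rel T -> ('I_k -> T) -> bool),
    forall f : fo k, (qdepth f <= D)%N ->
      exists s, forall (T : finType) (adj : rel T) env,
        eval adj f env = sem s T adj env.
  move=> HP.
  pose B : finType := ('I_k * 'I_k + 'I_k * 'I_k + P)%type.
  pose semB (b : B) (T : finType) (adj : rel T) (env : 'I_k -> T) : bool :=
    match b with
    | inl (inl ij) => adj (env ij.1) (env ij.2)
    | inl (inr ij) => env ij.1 == env ij.2
    | inr p => semP p T adj env
    end.
  exists {ffun {ffun B -> bool} -> bool},
    (fun (s : {ffun {ffun B -> bool} -> bool}) T adj env =>
       s [ffun b => semB b T adj env]).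
  move=> f; elim: f P semP HP @B @semB => {k}.
  - move=> k i j P semP HP B semB _.
    by exists [ffun v : {ffun B -> bool} => v (inl (inl (i, j)))] => T adj env;
       rewrite !ffunE.
  - move=> k i j P semP HP B semB _.
    by exists [ffun v : {ffun B -> bool} => v (inl (inr (i, j)))] => T adj env;
       rewrite !ffunE.
  - move=> k f IH P semP HP B semB /= /(IH P semP HP)[s Hs].
    by exists [ffun v => ~~ s v] => T adj env; rewrite ffunE Hs.
  - move=> k f IHf h IHh P semP HP B semB /=.
    rewrite geq_max => /andP[/(IHf P semP HP)[s Hs] /(IHh P semP HP)[t Ht]].
    by exists [ffun v => s v && t v] => T adj env; rewrite ffunE Hs Ht.
  - move=> k f IHf h IHh P semP HP B semB /=.
    rewrite geq_max => /andP[/(IHf P semP HP)[s Hs] /(IHh P semP HP)[t Ht]].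
    by exists [ffun v => s v || t v] => T adj env; rewrite ffunE Hs Ht.
  - move=> k f IHf h IHh P semP HP B semB /=.
    rewrite geq_max => /andP[/(IHf P semP HP)[s Hs] /(IHh P semP HP)[t Ht]].
    by exists [ffun v => s v ==> t v] => T adj env; rewrite ffunE Hs Ht.
  - move=> k f _ P semP HP B semB /= /HP[p Hp].
    by exists [ffun v : {ffun B -> bool} => v (inr p)] => T adj env;
       rewrite !ffunE Hp.
  - move=> k f _ P semP HP B semB /= df.
    have [p Hp] := HP (FNot f) df.
    exists [ffun v : {ffun B -> bool} => ~~ v (inr p)] => T adj env.
    by rewrite !ffunE /semB -Hp /= negb_exists; apply: eq_forallb => x; rewrite negbK.
elim: d m => [|d IHd] m.
  by apply: (step 0 m void (fun p => match p with end)) => f; rewrite ltn0.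
have [P [semP HP]] := IHd m.+1.
apply: (step d.+1 m P
  (fun p T adj env => [exists x, semP p T adj (env_cons x env)])) => f.
rewrite ltnS => /HP[p Hp]; exists p => T adj env.
by apply: eq_existsb => x; rewrite Hp.
Qed.

Lemma dev_max (R : realType) (k : R) (n : nat) : 1 <= k ->
  dev_set k n (dev k n) /\ forall x, dev_set k n x -> x <= dev k n.
Proof.
move=> k1; pose d := Num.truncn k.
have k0 : 0 <= k := le_trans ler01 k1.
have dP Phi : ((qdepth Phi)%:R <= k) = (qdepth Phi <= d)%N.
  by rewrite truncn_ge_nat.
have [S [sem Hsem]] := fo_finite d 0.
pose repr (s : S) (Phi : sentence) := (qdepth Phi <= d)%N /\
  forall (T : finType) (adj : rel T), models adj Phi = sem s T adj (@env_nil T).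
pose h (Phi : sentence) : R := `|prob R n Phi - limprob R Phi|.
have repr_h s Phi Psi : repr s Phi -> repr s Psi -> h Phi = h Psi.
  move=> [_ H1] [_ H2].
  have E i : prob R i Phi = prob R i Psi.
    by apply: eq_bigl => G; rewrite H1 H2.
  have EE : prob R ^~ Phi = prob R ^~ Psi by exact/funext.
  by rewrite /h /limprob E EE.
pose Phi0 : sentence := FEx (FEq ord0 ord0).
have ex_repr Phi : (qdepth Phi <= d)%N -> exists s, repr s Phi.
  by move=> dPhi; have [s Hs] := Hsem _ dPhi; exists s; split=> // T adj; exact: Hs.
have [s0 Hs0] : exists s, repr s Phi0.
  by apply: ex_repr; rewrite -dP.
pose A s := `[< exists Phi, repr s Phi >].
have [w Hw] : {w : S -> sentence & forall s, A s -> repr s (w s)}.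
  apply: (@boolp.choice S sentence (fun s Phi => A s -> repr s Phi)) => s.
  have [/asboolP[Phi HPhi]|_] := boolP (A s).
    by exists Phi.
  by exists Phi0.
have As0 : A s0 by apply/asboolP; exists Phi0.
case: (arg_maxP (fun s => h (w s)) As0) => s As smax.
have ub x : dev_set k n x -> x <= h (w s).
  move=> [Phi /=]; rewrite dP => dPhi <-.
  have [t Ht] := ex_repr _ dPhi.
  have At : A t by apply/asboolP; exists Phi.
  by rewrite -/(h Phi) (repr_h t _ (w t)) //; [exact: smax | exact: Hw].
have mem : dev_set k n (h (w s)).
  by exists (w s) => //=; rewrite dP; case: (Hw s As).
have -> : dev k n = h (w s).
  apply/eqP; rewrite eq_le; apply/andP; split.
    by apply: ge_sup => //; exists (h (w s)).
  by apply: ub_le_sup => //; exists (h (w s)).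
by [].
Qed.

(* Main.v *)
From Pilot Require Import Defs.
From HB Require Import structures.
From mathcomp Require Import all_boot all_order all_algebra.
From mathcomp Require Import all_classical all_reals all_analysis.
From mathcomp Require Import ring lra zify.

Set Implicit Arguments.
Unset Strict Implicit.
Unset Printing Implicit Defensive.

Import Order.TTheory GRing.Theory Num.Theory.
Import numFieldNormedType.Exports.

Local Open Scope classical_set_scope.
Local Open Scope ring_scope.

(** (1) Say that a graph is m-extendable if every subset A of every vertex set V
    of size at most m is the trace on V of some vertex outside V. By the
    Ehrenfeucht-Fraisse game, m-extendable graphs agree on all sentences of
    depth at most m + 1. The union bound gives failure probability at most
    (2n)^m (1 - 2^-m)^(n - m), which is O(1/n) as soon as m + 1 <= g(n) with
    c < 1.

    (2) Let Phi_m, of depth m + 1, say that every m vertices have a common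
    neighbour. At n = m^2 2^(m-3) its probability tends to 0, by the second
    moment method applied to the m-sets without common neighbour that are
    transversal to m disjoint blocks of 2^(m-3) vertices. For fixed m its
    probability tends to 1 as n grows. Finally, one new vertex repairs a given
    bad m-set with probability 2^-m, so p_{n+1}(Phi_m) <= p_n(Phi_m) + 2^-m and
    every gamma is approximated at some n >= m^2 2^(m-3); all these n satisfy
    m + 1 <= g(n). *)

(** * Uniform random subsets of a finite set, and independence *)

Section RandomSubset.
Import mathcomp.boot.fintype mathcomp.boot.finset.
Local Close Scope classical_set_scope.
Variable R : realType.
Implicit Types T : finType.

(** Expectation of [F] when each element of [E] is kept independently with probability 1/2. This law
    is uniform on the subsets of [E], so probability reduces to counting. *)
Definition avg T (E : {set T}) (F : {set T} -> R) : R :=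
  2^-1 ^+ #|E| * \sum_(G : {set T} | G \subset E) F G.

Lemma eq_avg T (E : {set T}) (F H : {set T} -> R) :
  (forall G : {set T}, G \subset E -> F G = H G) -> avg E F = avg E H.
Proof. by move=> FH; rewrite /avg (eq_bigr _ FH). Qed.

Lemma le_avg T (E : {set T}) (F H : {set T} -> R) :
  (forall G : {set T}, G \subset E -> F G <= H G) -> avg E F <= avg E H.
Proof.
by move=> FH; rewrite ler_wpM2l ?exprn_ge0 ?invr_ge0 ?ler0n // ler_sum.
Qed.

Lemma avg_cst T (E : {set T}) (a : R) : avg E (fun=> a) = a.
Proof.
rewrite /avg -(eq_bigl _ _ (fun G => powersetE G E)) sumr_const card_powerset.
by rewrite -[a *+ _]mulr_natl mulrA natrX -exprMn mulVf ?pnatr_eq0 // expr1n mul1r.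
Qed.

Lemma avgD T (E : {set T}) (F H : {set T} -> R) :
  avg E (fun G => F G + H G) = avg E F + avg E H.
Proof. by rewrite /avg big_split mulrDr. Qed.

Lemma avgZ T (E : {set T}) (a : R) (F : {set T} -> R) :
  avg E (fun G => a * F G) = a * avg E F.
Proof. by rewrite /avg -mulr_sumr mulrCA. Qed.

Lemma avgB T (E : {set T}) (F H : {set T} -> R) :
  avg E (fun G => F G - H G) = avg E F - avg E H.
Proof. by rewrite /avg sumrB mulrBr. Qed.

Lemma avg_sum T (I : finType) (P : pred I) (E : {set T})
    (F : I -> {set T} -> R) :
  avg E (fun G => \sum_(i | P i) F i G) = \sum_(i | P i) avg E (F i).
Proof. by rewrite /avg exchange_big mulr_sumr. Qed.

(** Fubini: a subset of a disjoint union is uniquely a pair of subsets of the two parts. *)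
Lemma avgU T (E1 E2 : {set T}) (F : {set T} -> R) : [disjoint E1 & E2] ->
  avg (E1 :|: E2) F = avg E1 (fun A => avg E2 (fun B => F (A :|: B))).
Proof.
move=> dis; rewrite /avg cardsU (disjoint_setI0 dis) cards0 subn0 exprD -mulrA.
congr (_ * _); rewrite -mulr_sumr; congr (_ * _).
rewrite pair_big /= (reindex_onto (fun p : {set T} * {set T} => p.1 :|: p.2)
  (fun G => (G :&: E1, G :&: E2))) => [|G /setIidPl GE] /=; last first.
  by rewrite -setIUr.
apply: eq_bigl => -[A B] /=; rewrite subUset xpair_eqE.
apply/idP/idP=> [/andP[_ /andP[/eqP <- /eqP <-]]|/andP[AE BE]].
  by rewrite !subsetIr.
have AE2 : A :&: E2 = set0.
  by apply: disjoint_setI0; apply: disjointWl AE dis.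
have BE1 : B :&: E1 = set0.
  by apply: disjoint_setI0; apply: disjointWl BE _; rewrite disjoint_sym.
rewrite !setIUl AE2 BE1 setU0 set0U (setIidPl AE) (setIidPl BE) !eqxx andbT.
by rewrite (subset_trans AE (subsetUl _ _)) (subset_trans BE (subsetUr _ _)).
Qed.

(** Independence of two variables that look only at disjoint parts of the random set. *)
Lemma avgM T (E1 E2 : {set T}) (F1 F2 : {set T} -> R) : [disjoint E1 & E2] ->
  (forall G : {set T}, G \subset E1 :|: E2 -> F1 G = F1 (G :&: E1)) ->
  (forall G : {set T}, G \subset E1 :|: E2 -> F2 G = F2 (G :&: E2)) ->
  avg (E1 :|: E2) (fun G => F1 G * F2 G) = avg E1 F1 * avg E2 F2.
Proof.
move=> dis H1 H2; rewrite avgU //.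
rewrite [RHS]mulrC -avgZ; apply: eq_avg => A AE.
rewrite mulrC -avgZ; apply: eq_avg => B BE.
have ABE : A :|: B \subset E1 :|: E2 by apply: setUSS.
have AE2 : A :&: E2 = set0.
  by apply: disjoint_setI0; apply: disjointWl AE dis.
have BE1 : B :&: E1 = set0.
  by apply: disjoint_setI0; apply: disjointWl BE _; rewrite disjoint_sym.
rewrite H1 // H2 // !setIUl AE2 BE1 setU0 set0U.
by rewrite (setIidPl AE) (setIidPl BE).
Qed.

Lemma avg_local T (E E1 : {set T}) (F : {set T} -> R) : E1 \subset E ->
  (forall G : {set T}, G \subset E -> F G = F (G :&: E1)) ->
  avg E F = avg E1 F.
Proof.
move=> sub loc; have EE : E = E1 :|: (E :\: E1).
  by rewrite -{1}(setID E E1) (setIidPr sub).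
have dis : [disjoint E1 & E :\: E1].
  by rewrite -setI_eq0 setDE setICA setICr setI0.
have := @avgM _ E1 (E :\: E1) F (fun=> 1) dis.
rewrite -EE avg_cst mulr1 => <- //; by apply: eq_avg => G _; rewrite mulr1.
Qed.

(** Used to read a star of edges as its set of far endpoints, and to embed the pairs of n vertices
    among those of n + 1. *)
Lemma avg_imset (T1 T2 : finType) (h : T1 -> T2) (E : {set T1})
    (F : {set T2} -> R) : injective h ->
  avg (h @: E) F = avg E (fun A => F (h @: A)).
Proof.
move=> hI; rewrite /avg card_imset //; congr (_ * _).
have K (A : {set T1}) : h @^-1: (h @: A) = A.
  by apply/setP=> x; rewrite inE mem_imset.
rewrite (reindex_onto (fun A : {set T1} => h @: A) (fun B => h @^-1: B)) /=.
  apply: eq_bigl => A; rewrite K eqxx andbT.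
  apply/idP/idP=> [|/(imsetS h) //].
  by move/(preimsetS h); rewrite !K.
move=> B BE; apply/setP=> y; apply/imsetP/idP=> [[x + ->]|By].
  by rewrite inE.
by have /imsetP[x _ yx] := subsetP BE y By; exists x; rewrite ?inE -?yx.
Qed.

Lemma avg_eq1 T (V A : {set T}) : A \subset V ->
  avg V (fun G => (G == A)%:R) = 2^-1 ^+ #|V|.
Proof.
move=> AV; rewrite /avg (bigD1 A) //= eqxx big1 ?addr0 ?mulr1 //.
by move=> G /andP[_ /negPf ->].
Qed.

Lemma avg_superset T (V S : {set T}) : S \subset V ->
  avg V (fun G => (S \subset G)%:R) = 2^-1 ^+ #|S|.
Proof.
move=> SV; rewrite (@avg_local _ V S) => [|//|G _]; last first.
  by rewrite subsetI subxx andbT.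
rewrite -(@avg_eq1 _ S S) //; apply: eq_avg => G GS.
by rewrite eqEsubset GS.
Qed.

End RandomSubset.

(** * Traces of outside vertices, and the union bound for extendability *)

Section Traces.
Import mathcomp.boot.fintype mathcomp.boot.finset Pilot.Defs.
Local Close Scope classical_set_scope.
Variable R : realType.

Definition trace (T : finType) (adj : rel T) (z : T) (V : {set T}) : {set T} :=
  [set v in V | adj z v].

Lemma adjacent_sym n (G : {set {set 'I_n}}) : symmetric (adjacent G).
Proof. by move=> x y; rewrite /adjacent setUC. Qed.

Lemma adjacent_irr n (G : {set {set 'I_n}}) : G \subset pairs n ->
  irreflexive (adjacent G).
Proof.
move=> GP x; apply/negP=> /(subsetP GP).
by rewrite inE setUid cards1.
Qed.

Lemma set2_inj (T : finType) (z : T) : injective (fun v => [set z; v]).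
Proof.
move=> v w /setP vw.
have := vw v; have := vw w; rewrite !inE !eqxx !orbT.
by case: eqVneq => [->|_ /= /eqP //]; case: eqVneq => // ->.
Qed.

Lemma prob_avg n (Phi : sentence) :
  prob R n Phi = avg (pairs n) (fun G => (models (adjacent G) Phi)%:R).
Proof.
rewrite /prob /avg mulr_sumr big_mkcondr; apply: eq_bigr => G _.
rewrite /gnq_mass; case: ifP; rewrite ?mulr0 // mulr1 => _.
have -> : 1 - 2^-1 = 2^-1 :> R by lra.
by under eq_bigr do rewrite if_same; rewrite prodr_const.
Qed.

(** The trace of [z] on [V] is determined by the edges from [z] to [V]. For distinct [z] outside [V]
    these stars are disjoint, so the traces are independent uniform subsets of [V]. The induction
    peels off one star [E1] at a time. *)
Lemma avg_traces n (V Z : {set 'I_n}) (Q : pred {set 'I_n}) :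
  [disjoint Z & V] ->
  avg (pairs n) (fun G => [forall z in Z, Q (trace (adjacent G) z V)]%:R)
  = avg V (fun A => (Q A)%:R) ^+ #|Z| :> R.
Proof.
move Ek : #|Z| => k; elim: k Z Ek => [|k IH] Z Ek dis.
  rewrite expr0 -[RHS](avg_cst (pairs n)); apply: eq_avg => G _.
  have -> : Z = set0 by apply/eqP; rewrite -cards_eq0 Ek.
  by case: forall_inP => // -[] z; rewrite inE.
have [z zZ] : exists z, z \in Z by apply/set0Pn; rewrite -cards_eq0 Ek.
have zV : z \notin V by have := disjointFr dis zZ => ->.
pose E1 := (fun v => [set z; v]) @: V.
have E1P : E1 \subset pairs n.
  apply/subsetP=> _ /imsetP[v vV ->]; rewrite inE cards2.
  by have -> : z != v by apply: contraNneq zV => ->.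
have PE : pairs n = E1 :|: (pairs n :\: E1).
  by rewrite -{1}(setID (pairs n) E1) (setIidPr E1P).
have dE : [disjoint E1 & pairs n :\: E1].
  by rewrite -setI_eq0 setDE setICA setICr setI0.
have loc1 (G : {set {set 'I_n}}) :
    trace (adjacent (G :&: E1)) z V = trace (adjacent G) z V.
  apply/setP=> v; rewrite !inE /adjacent inE.
  by case vV : (v \in V) => //=; rewrite (mem_imset _ _ (@set2_inj _ z)) vV andbT.
have loc2 (G : {set {set 'I_n}}) z' : G \subset pairs n -> z' \in Z :\ z ->
    trace (adjacent (G :&: (pairs n :\: E1))) z' V = trace (adjacent G) z' V.
  move=> GP /setD1P[z'z z'Z]; apply/setP=> v; rewrite !inE /adjacent !in_setI.
  case vV : (v \in V) => //=; case GG : (_ \in G) => //=.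
  (* An edge at [z'] lying in the star of [z] would force [z'] into [V], as [z'] differs from
     [z]. *)
  rewrite in_setD (subsetP GP) // andbT; apply/negP=> /imsetP[w wV /setP/(_ z')].
  rewrite !inE eqxx /= (negPf z'z) /= => /esym/eqP z'w.
  by have := disjointFr dis z'Z; rewrite z'w wV.
pose F1 (G : {set {set 'I_n}}) : R := (Q (trace (adjacent G) z V))%:R.
pose F2 (G : {set {set 'I_n}}) : R :=
  [forall z' in Z :\ z, Q (trace (adjacent G) z' V)]%:R.
have F2loc (G : {set {set 'I_n}}) : G \subset pairs n ->
    F2 G = F2 (G :&: (pairs n :\: E1)).
  move=> GP; congr (_ (nat_of_bool _)); apply: eq_forallb_in => z' z'Z.
  by rewrite loc2.
transitivity (avg (pairs n) (fun G => F1 G * F2 G)).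
  apply: eq_avg => G _; rewrite /F1 /F2 -natrM mulnb; congr (nat_of_bool _)%:R.
  apply/forall_inP/andP=> [H|[Hz /forall_inP H] z' z'Z].
    split; first exact: H.
    by apply/forall_inP=> z' /setD1P[_ /H].
  by case: (eqVneq z' z) => [->//|z'z]; apply: H; rewrite !inE z'z.
rewrite PE avgM -?PE // => [|G _]; last by rewrite /F1 loc1.
rewrite exprS; congr (_ * _).
  rewrite avg_imset; last exact: set2_inj.
  apply: eq_avg => A AV; rewrite /F1; congr (Q _)%:R; apply/setP=> v.
  rewrite inE /adjacent (mem_imset _ _ (@set2_inj _ z)).
  by rewrite andb_idl // => /(subsetP AV).
rewrite -(@avg_local _ _ (pairs n)) ?subsetDl //.
apply: IH; last by apply: disjointWl dis; rewrite subsetDl.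
by move: (cardsD1 z Z); rewrite zZ Ek => -[].
Qed.

Definition extends (T : finType) (m : nat) (adj : rel T) : bool :=
  [forall V : {set T}, (#|V| <= m)%N ==> [forall A : {set T}, (A \subset V) ==>
    [exists z, (z \notin V) && (trace adj z V == A)]]].

Lemma superset_card (T : finType) (V : {set T}) m :
  (#|V| <= m <= #|T|)%N -> exists2 U : {set T}, V \subset U & #|U| = m.
Proof.
elim: m => [|m IH] /andP[Vm mT].
  by exists V => //; apply/eqP; rewrite -leqn0.
move: Vm; rewrite leq_eqVlt => /orP[/eqP Vm|Vm]; first by exists V.
have [U VU Um] := IH (introT andP (conj Vm (ltnW mT))).
have [x xU] : exists x, x \in ~: U.
  by apply/set0Pn; rewrite -card_gt0 cardsCs setCK Um subn_gt0.
exists (x |: U); first by apply: subset_trans VU (subsetUr _ _).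
by move: xU; rewrite inE cardsU1 Um => ->.
Qed.

(** A missed trace [A] on a smaller set stays missed, as the same [A], on any m-set containing it;
    hence the union bound runs over sets of size exactly m. *)
Lemma extendsN (T : finType) (m : nat) (adj : rel T) : (m <= #|T|)%N ->
  ~~ extends m adj -> exists V A : {set T},
    [/\ #|V| = m, A \subset V & [forall z in ~: V, trace adj z V != A]].
Proof.
move=> mT; rewrite negb_forall => /existsP[V]; rewrite negb_imply.
move=> /andP[Vm]; rewrite negb_forall => /existsP[A]; rewrite negb_imply.
move=> /andP[AV /existsPn H].
have [U VU Um] : exists2 U : {set T}, V \subset U & #|U| = m.
  by apply: superset_card; rewrite Vm.
exists U, A; split=> //; first exact: subset_trans AV VU.
apply/forall_inP=> z; rewrite inE => zU; apply/eqP=> /setP tr.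
have := H z; rewrite (contra (subsetP VU z)) //=; apply/negP/negPn/eqP/setP=> v.
have := tr v; rewrite !inE; case vV : (v \in V) => /=.
  by rewrite (subsetP VU).
by move=> _; apply/esym/negbTE/negP=> /(subsetP AV); rewrite vV.
Qed.

(** Union bound over at most n^m sets [V] and 2^m traces [A]; each of the n - m outside vertices
    misses [A] independently with probability 1 - 2^-m. *)
Lemma avg_not_extends n m : (m <= n)%N ->
  avg (pairs n) (fun G => (~~ extends m (adjacent G))%:R)
  <= (2 * n%:R) ^+ m * (1 - 2^-1 ^+ m) ^+ (n - m) :> R.
Proof.
move=> mn.
pose F (V A : {set 'I_n}) (G : {set {set 'I_n}}) : R :=
  [forall z in ~: V, trace (adjacent G) z V != A]%:R.
apply: (@le_trans _ _ (avg (pairs n) (fun G =>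
    \sum_(V : {set 'I_n} | #|V| == m) \sum_(A : {set 'I_n} | A \subset V)
      F V A G))).
  apply: le_avg => G _; have [_|] := boolP (extends _ _); rewrite ?ler01 /=.
    by rewrite !sumr_ge0 // => V _; rewrite sumr_ge0 // => A _; exact: ler0n.
  move/(extendsN (adj := adjacent G)); rewrite card_ord => /(_ mn)[V [A [Vm AV H]]].
  rewrite (bigD1 V) ?Vm //= (bigD1 A) //= {1}/F H -addrA lerDl addr_ge0 //.
    by rewrite sumr_ge0 // => B _; exact: ler0n.
  by rewrite sumr_ge0 // => W _; rewrite sumr_ge0 // => B _; exact: ler0n.
rewrite avg_sum.
have E (V : {set 'I_n}) : #|V| == m ->
    avg (pairs n) (fun G => \sum_(A : {set 'I_n} | A \subset V) F V A G)
    = 2 ^+ m * (1 - 2^-1 ^+ m) ^+ (n - m).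
  move=> /eqP Vm; rewrite avg_sum.
  rewrite (eq_bigr (fun=> (1 - 2^-1 ^+ m) ^+ (n - m))) => [|A AV].
    rewrite -(eq_bigl _ _ (fun G => powersetE G V)) sumr_const card_powerset Vm.
    by rewrite -[_ *+ _]mulr_natl natrX.
  rewrite (@avg_traces n V (~: V) (fun B => B != A)).
    rewrite cardsCs setCK card_ord Vm; congr (_ ^+ _).
    rewrite -[in RHS]Vm -(avg_eq1 R AV) -[X in X - _](avg_cst V) -avgB.
    by apply: eq_avg => B _; case: eqP => _; rewrite ?subrr ?subr0.
  by rewrite -setI_eq0 setIC setICr.
rewrite (eq_bigr _ E) sumr_const.
have -> : #|(fun i : {set 'I_n} => #|i| == m)| = 'C(n, m).
  by rewrite -[n in RHS]card_ord -card_draws; apply: eq_card => A; rewrite inE.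
rewrite exprMn -[X in X <= _]mulr_natl mulrA ler_wpM2r //.
  rewrite exprn_ge0 // subr_ge0 exprn_ile1 ?invr_ge0 ?ler0n //.
  by rewrite invf_le1 ?ltr0n // ler1n.
rewrite mulrC ler_wpM2l ?exprn_ge0 ?ler0n // -natrX ler_nat.
apply: leq_trans (_ : n ^_ m <= _)%N.
  by rewrite -bin_ffact leq_pmulr // fact_gt0.
elim: m {mn F E} => // m IH; rewrite ffactnSr expnSr.
by rewrite leq_mul // leq_subr.
Qed.

End Traces.

(** * The Ehrenfeucht-Fraisse game on extendable graphs *)

Section Game.
Import mathcomp.boot.fintype mathcomp.boot.finset Pilot.Defs.
Local Close Scope classical_set_scope.

(** A winning position for Duplicator, indexed by variables so that a vertex may be chosen
    repeatedly. *)
Definition partial_iso (T U : finType) (a : rel T) (b : rel U) j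
    (e : 'I_j -> T) (e' : 'I_j -> U) :=
  forall i i', (e i == e i') = (e' i == e' i') /\ a (e i) (e i') = b (e' i) (e' i').

Lemma partial_iso_sym (T U : finType) (a : rel T) (b : rel U) j
    (e : 'I_j -> T) (e' : 'I_j -> U) :
  partial_iso a b e e' -> partial_iso b a e' e.
Proof. by move=> H i i'; have [-> ->] := H i i'. Qed.

Lemma partial_iso_extend (T U : finType) (a : rel T) (b : rel U) m j
    (e : 'I_j -> T) (e' : 'I_j -> U) (x : T) :
  symmetric a -> symmetric b -> irreflexive a -> irreflexive b ->
  extends m b -> (j <= m)%N -> partial_iso a b e e' ->
  exists y, partial_iso a b (env_cons x e) (env_cons y e').
Proof.
move=> sa sb ia ib ext jm iso.
have [y [yeq yadj]] : exists y, (forall i, (x == e i) = (y == e' i)) /\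
    (forall i, a x (e i) = b y (e' i)).
  (* A repeated vertex is answered by the vertex of the same index; a new one by a vertex outside
     the image of [e'] with the prescribed trace. *)
  have [/existsP[i0 /eqP ->]|/existsPn new] := boolP [exists i, x == e i].
    by exists (e' i0); split=> i; case: (iso i0 i).
  pose V := [set e' i | i : 'I_j]; pose A := [set e' i | i : 'I_j & a x (e i)].
  have Vm : (#|V| <= m)%N.
    by apply: leq_trans jm; rewrite -[X in (_ <= X)%N]card_ord leq_imset_card.
  have AV : A \subset V by apply/subsetP=> _ /imsetP[i _ ->]; apply: imset_f.
  move/forallP/(_ V)/implyP/(_ Vm)/forallP/(_ A)/implyP/(_ AV): ext.
  move=> /existsP[y /andP[yV /eqP yA]]; exists y; split=> i.
    rewrite (negPf (new i)); apply/esym; apply: contraNF yV => /eqP ->.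
    exact: imset_f.
  have := congr1 (fun B : {set U} => e' i \in B) yA; rewrite !inE imset_f //= => ->.
  apply/idP/imsetP=> [ai|[i' + ee]]; first by exists i; rewrite ?inE.
  by rewrite inE; have [] := iso i i'; rewrite ee eqxx => /eqP ->.
exists y => i i'; rewrite /env_cons.
case: unliftP => [k _|_]; case: unliftP => [k' _|_].
- exact: iso.
- by rewrite eq_sym yeq eq_sym sa yadj sb.
- by rewrite yeq yadj.
- by rewrite !eqxx ia ib.
Qed.

(** The last of m + 1 moves is answered against only m chosen vertices, so m-extendability handles
    depth m + 1. *)
Lemma eval_partial_iso (T U : finType) (a : rel T) (b : rel U) m j (f : fo j)
    (e : 'I_j -> T) (e' : 'I_j -> U) :
  symmetric a -> symmetric b -> irreflexive a -> irreflexive b ->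
  extends m a -> extends m b -> (j + qdepth f <= m.+1)%N ->
  partial_iso a b e e' -> eval a f e = eval b f e'.
Proof.
move=> sa sb ia ib xa xb.
have ex k (h : fo k.+1) (d : 'I_k -> T) (d' : 'I_k -> U) :
    (forall d1 d1', (k.+1 + qdepth h <= m.+1)%N -> partial_iso a b d1 d1' ->
      eval a h d1 = eval b h d1') ->
    (k + (qdepth h).+1 <= m.+1)%N -> partial_iso a b d d' ->
    (forall x, exists y, eval a h (env_cons x d) = eval b h (env_cons y d')) /\
    (forall y, exists x, eval a h (env_cons x d) = eval b h (env_cons y d')).
  rewrite -addSnnS => IH km iso.
  have jm : (k <= m)%N by apply: leq_trans (leq_addr _ _) _; rewrite addSn in km; exact: km.
  split=> [x|y].
    have [y iso'] := partial_iso_extend x sa sb ia ib xb jm iso.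
    by exists y; apply: IH.
  have [x iso'] := partial_iso_extend y sb sa ib ia xa jm (partial_iso_sym iso).
  by exists x; apply: IH => //; apply: partial_iso_sym.
elim: f e e' => {j} [j i i'|j i i'|j f IH|j f IHf h IHh|j f IHf h IHh|j f IHf h IHh
  |j f IH|j f IH] e e' /=.
- by move=> _ /(_ i i')[].
- by move=> _ /(_ i i')[].
- by move=> jm iso; rewrite (IH e e').
- rewrite addn_maxr geq_max => /andP[jf jh] iso.
  by rewrite (IHf e e') // (IHh e e').
- rewrite addn_maxr geq_max => /andP[jf jh] iso.
  by rewrite (IHf e e') // (IHh e e').
- rewrite addn_maxr geq_max => /andP[jf jh] iso.
  by rewrite (IHf e e') // (IHh e e').
- move=> jm iso; have [H1 H2] := ex _ _ _ _ IH jm iso.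
  apply/existsP/existsP=> -[x Hx].
    by have [y xy] := H1 x; exists y; rewrite -xy.
  by have [y xy] := H2 x; exists y; rewrite xy.
- move=> jm iso; have [H1 H2] := ex _ _ _ _ IH jm iso.
  apply/forallP/forallP=> Hx x.
    by have [y <-] := H2 x.
  by have [y ->] := H1 x.
Qed.

Lemma models_extends (T U : finType) (a : rel T) (b : rel U) m (Phi : sentence) :
  symmetric a -> symmetric b -> irreflexive a -> irreflexive b ->
  extends m a -> extends m b -> (qdepth Phi <= m.+1)%N ->
  models a Phi = models b Phi.
Proof. by move=> *; apply: (@eval_partial_iso _ _ _ _ m) => // -[]. Qed.

(** The value [v] serves all n at once because extendable graphs of different orders also agree on
    [Phi]. *)
Lemma prob_near_bool (R : realType) m (Phi : sentence) :
  (qdepth Phi <= m.+1)%N -> exists v : bool, forall n, (m <= n)%N ->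
  `|prob R n Phi - v%:R| <= (2 * n%:R) ^+ m * (1 - 2^-1 ^+ m) ^+ (n - m).
Proof.
move=> dm.
have [v Hv] : exists v, forall n (G : {set {set 'I_n}}), G \subset pairs n ->
    extends m (adjacent G) -> models (adjacent G) Phi = v.
  have [[n [G [GP GE]]]|H] := pselect (exists n (G : {set {set 'I_n}}),
      G \subset pairs n /\ extends m (adjacent G)).
    exists (models (adjacent G) Phi) => n' G' GP' GE'.
    by apply: (@models_extends _ _ _ _ m) => //;
      by [exact: adjacent_sym | exact: adjacent_irr].
  (* Default value for the case where no graph on any ['I_n] is m-extendable. *)
  by exists true => n G GP GE; exfalso; apply: H; exists n, G.
exists v => n mn; apply: le_trans (avg_not_extends R mn).
rewrite prob_avg -[X in _ - X](avg_cst (pairs n)) -avgB ler_norml.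
rewrite -mulN1r -avgZ; apply/andP; split; apply: le_avg => G GP.
- have [/(Hv _ _ GP) ->|_] := boolP (extends _ _); first by rewrite mulr0 subrr.
  by case: (models _ _); case: (v) => /=; lra.
- have [/(Hv _ _ GP) ->|_] := boolP (extends _ _); first by rewrite subrr.
  by case: (models _ _); case: (v) => /=; lra.
Qed.

End Game.

(** * Estimates on g, the zero-one law, and convergence for c < 1 *)

Section Asymptotics.
Variable R : realType.
Implicit Types c : R.

Lemma ln2_ge_half : 2^-1 <= ln 2 :> R.
Proof.
have := expR_ge1Dx (- 2^-1 : R); rewrite expRN => h.
rewrite -[X in X <= _]expRK ler_ln ?posrE ?expR_gt0 ?ltr0n //.
rewrite -[expR _]invrK invf_ple ?posrE ?ltr0n ?invr_gt0 ?expR_gt0 //.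
by apply: le_trans h; lra.
Qed.

Lemma ln2_gt0 : 0 < ln 2 :> R.
Proof. by apply: lt_le_trans ln2_ge_half; rewrite invr_gt0 ltr0n. Qed.

Lemma ln2_le1 : ln 2 <= 1 :> R.
Proof. by have := @le_ln1Dx R 1 ltac:(lra); rewrite -[1 + 1]/2. Qed.

Lemma lnln2_le0 : ln (ln 2) <= 0 :> R.
Proof. exact: ln_le0 ln2_le1. Qed.

Lemma lnln2_ge : - ln 2 <= ln (ln 2) :> R.
Proof.
rewrite -lnV ?posrE ?ltr0n // ler_ln ?posrE ?invr_gt0 ?ltr0n ?ln2_gt0 //.
exact: ln2_ge_half.
Qed.

(** Scaling by ln 2 makes later comparisons linear in natural logarithms; log2 e is 1 / ln 2. *)
Lemma g_ln2 c n : g c n * ln 2 =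
  ln n%:R - 2 * ln (log2 n%:R) - ln (ln 2) + c * ln 2 :> R.
Proof.
have a0 : ln 2 != 0 :> R by rewrite gt_eqF ?ln2_gt0.
have E : log2 (expR 1) = (ln 2)^-1 :> R by rewrite /log2 expRK mul1r.
rewrite /g E /log2 lnV ?posrE ?ln2_gt0 //.
by field.
Qed.

(** With a = ln 2, L = log2 n and q = 2^-m, the bound is at most exp (m (a + a L) - q (n - m)). Here
    m <= L - 1 and q n >= a L^2 (1 + d), so the gain d from c < 1 leaves an exponent of at most 1 -
    a L. The estimate is uniform in [m], which will vary with [n]. *)
Lemma extension_failure_small c : c < 1 ->
  \forall n \near \oo, forall m, m.+1%:R <= g c n ->
    (m <= n)%N /\
    (2 * n%:R) ^+ m * (1 - 2^-1 ^+ m) ^+ (n - m) <= expR 1 / n%:R :> R.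
Proof.
move=> c1; set a : R := ln 2; set d : R := (1 - c) * a.
have a0 : 0 < a by exact: ln2_gt0.
have a1 : a <= 1 by exact: ln2_le1.
have d0 : 0 < d by rewrite mulr_gt0 // subr_gt0.
near=> n => m.
(* This threshold yields both L >= 2 and d L >= 1. *)
have nB : expR (2 + d^-1) <= n%:R by near: n; exact: nbhs_infty_ger.
have n0 : 0 < n%:R :> R by apply: lt_le_trans nB; exact: expR_gt0.
have lnB : 2 + d^-1 <= ln n%:R by rewrite -[X in X <= _]expRK ler_ln ?posrE ?expR_gt0.
set L : R := log2 n%:R.
have aL : ln n%:R = a * L by rewrite /L /log2 mulrC divfK // gt_eqF.
have dV0 : 0 < d^-1 by rewrite invr_gt0.
have lnL : ln n%:R <= L.
  by rewrite aL ler_piMl //; rewrite aL in lnB; nra.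
have L2 : 2 <= L by lra.
have dL : 1 <= d * L.
  have : d * d^-1 <= d * L by rewrite ler_pM2l //; lra.
  by rewrite divff // gt_eqF.
have L0 : 0 < L by lra.
rewrite -(ler_pM2r a0) g_ln2 -/a -/L aL => Hm.
have lnL2 : a <= ln L by rewrite ler_ln ?posrE ?ltr0n.
have lna : - a <= ln a by exact: lnln2_ge.
have ca : c * a < a by rewrite gtr_pMl.
have mL : m%:R + 1 <= L.
  by rewrite -(ler_pM2r a0) natr1; lra.
have m0 : 0 <= m%:R :> R by exact: ler0n.
have pow2 : expR (m%:R * a) = 2 ^+ m by rewrite expRM_natl lnK // posrE ltr0n.
have mn : (2 ^ m <= n)%N.
  rewrite -(ler_nat R) natrX -pow2 -[X in _ <= X]lnK ?posrE // ler_expR aL.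
  by rewrite mulrC ler_pM2l //; lra.
have m2 : (m < 2 ^ m)%N by apply: ltn_expl.
have mn' : (m <= n)%N by exact: leq_trans (ltnW m2) mn.
split=> //.
set q : R := 2^-1 ^+ m.
have qE : q = expR (- (m%:R * a)) by rewrite expRN pow2 /q exprVn.
have qm : q * m%:R <= 1.
  rewrite /q exprVn mulrC ler_pdivrMr ?exprn_gt0 ?ltr0n // mul1r -natrX ler_nat.
  exact: ltnW.
have qn : a * L ^+ 2 * (1 + d) <= q * n%:R.
  rewrite qE -[n%:R]lnK ?posrE // -expRD aL.
  apply: (@le_trans _ _ (expR (ln a + 2 * ln L + d))); last first.
    by rewrite ler_expR /d; move: Hm; rewrite -natr1; lra.
  rewrite !expRD lnK ?posrE // (expRM_natl 2) lnK ?posrE //.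
  by rewrite ler_wpM2l ?expR_ge1Dx // mulr_ge0 ?exprn_ge0 // ltW.
have -> : (2 * n%:R) ^+ m = expR (m%:R * (a + a * L)) :> R.
  by rewrite expRM_natl expRD -aL !lnK ?posrE ?n0 ?ltr0n.
have -> : expR 1 / n%:R = expR (1 - a * L) :> R.
  by rewrite expRB -aL lnK ?posrE.
apply: (@le_trans _ _ (expR (m%:R * (a + a * L)) * expR ((n - m)%:R * - q))).
  rewrite ler_wpM2l ?expR_ge0 // expRM_natl lerXn2r ?nnegrE ?expR_ge0 //.
    rewrite subr_ge0 exprn_ile1 ?invr_ge0 ?ler0n //.
    by rewrite invf_le1 ?ltr0n // ler1n.
  exact: expR_ge1Dx.
rewrite -expRD ler_expR natrB // mulrBl !mulrN opprK.
have h1 : m%:R * (a + a * L) <= (L - 1) * (a + a * L).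
  by apply: ler_wpM2r; have := mulr_gt0 a0 L0; lra.
have h2 : a * L <= a * L ^+ 2 * d.
  by rewrite -mulrA ler_pM2l // expr2 -mulrA ler_pMr // mulrC.
have -> : m%:R * q = q * m%:R by rewrite mulrC.
have -> : n%:R * q = q * n%:R by rewrite mulrC.
lra.
Unshelve. all: end_near. Qed.

(** At N = m^2 2^(m-3), log2 N is m - 3 + 2 log2 m and at most 2m, so subtracting 2 log2 (log2 N)
    leaves at least m - 5; since log2 (log2 e) >= 0, adding 6 reaches m + 1. Larger n are handled by
    monotonicity of L - 2 log2 L for L >= 4. *)
Lemma g_ge c m n : 6 <= c -> (4 <= m)%N -> (m ^ 2 * 2 ^ (m - 3) <= n)%N ->
  m.+1%:R <= g c n.
Proof.
move=> c6 m4 mn; set a : R := ln 2.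
have a0 : 0 < a by exact: ln2_gt0.
have ah : 2^-1 <= a by exact: ln2_ge_half.
have mpos : (0 < m)%N by exact: leq_trans m4.
have mR : 4 <= m%:R :> R by rewrite ler_nat.
have m0 : 0 < m%:R :> R by lra.
have m2 : (m ^ 2 <= 2 ^ m)%N.
  move: m4; clear; elim: m => // m IH.
  rewrite leq_eqVlt => /orP[/eqP <- //|]; rewrite ltnS => m4.
  by have := IH m4; rewrite [(2 ^ m.+1)%N]expnS -!mulnn; nia.
have mpos2 : (0 < m ^ 2)%N by rewrite expn_gt0 mpos.
have lnm : 2 * ln m%:R <= m%:R * a.
  have : ln ((m ^ 2)%:R : R) <= ln (2 ^ m)%:R.
    by rewrite ler_ln ?posrE ?ltr0n ?expn_gt0 ?ler_nat ?mpos.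
  by rewrite !natrX !lnXn ?ltr0n ?mpos // !mulr_natl.
have lnm4 : 2 * a <= ln m%:R.
  have : ln (2 ^+ 2 : R) <= ln m%:R.
    by rewrite ler_ln ?posrE ?ltr0n //; lra.
  by rewrite lnXn // mulr_natl.
set N : R := (m ^ 2 * 2 ^ (m - 3))%:R.
have N0 : 0 < N by rewrite ltr0n muln_gt0 !expn_gt0 mpos.
have n0 : 0 < n%:R :> R by apply: lt_le_trans N0 _; rewrite ler_nat.
have lnN : ln N = 2 * ln m%:R + (m%:R - 3) * a.
  rewrite /N natrM lnM ?posrE ?ltr0n ?expn_gt0 ?mpos //.
  rewrite !natrX !lnXn ?ltr0n ?mpos //.
  by rewrite -[ln 2 *+ _]mulr_natl -[ln m%:R *+ _]mulr_natl natrB // ltnW.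
have lnNn : ln N <= ln n%:R by rewrite ler_ln ?posrE // ler_nat.
set L : R := log2 n%:R; set M : R := log2 N.
have aL : ln n%:R = a * L by rewrite /L /log2 mulrC divfK // gt_eqF.
have aM : ln N = a * M by rewrite /M /log2 mulrC divfK // gt_eqF.
have ML : M <= L by rewrite -(ler_pM2l a0) -aL -aM.
have M4 : 4 <= M by rewrite -(ler_pM2l a0) -aM lnN; nra.
have M2 : M <= 2 * m%:R by rewrite -(ler_pM2l a0) -aM lnN; nra.
have lnM' : ln M <= a + ln m%:R.
  rewrite -lnM ?posrE ?ltr0n ?mpos //.
  by rewrite ler_ln ?posrE; lra.
(* Tangent line of ln at M; with M >= 4 and ln 2 >= 1/2, 2 ln L grows no faster than L ln 2. *)
have lnL : ln L <= ln M + (L - M) / M.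
  have -> : L = M * (1 + (L - M) / M) by field; lra.
  have lm0 : 0 <= (L - M) / M by rewrite divr_ge0 //; lra.
  rewrite lnM ?posrE; [|lra|lra].
  rewrite lerD2l; apply: (le_trans (le_ln1Dx _)); first by lra.
  by have -> : M * (1 + (L - M) / M) = L by field; lra.
have LM4 : (L - M) / M <= (L - M) / 4.
  by rewrite ler_wpM2l ?subr_ge0 // lef_pV2 ?posrE //; lra.
rewrite -(ler_pM2r a0) g_ln2 -/a -/L aL -natr1.
have := lnln2_le0; rewrite -/a => lna.
have c6a : 6 * a <= c * a by rewrite ler_pM2r.
have LMa : 2 * ((L - M) / 4) <= a * (L - M) by nra.
lra.
Qed.

Lemma g_near c (m : nat) : \forall n \near \oo, m.+1%:R <= g c n.
Proof.
have [k Hk] : exists k : nat, 6 - c <= k%:R.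
  have /archi_boundP : 0 <= `|6 - c| by [].
  by set k := Num.bound _ => h; exists k; rewrite (le_trans (ler_norm _)) // ltW.
(* Shifting c by [k] reaches the range c >= 6 of [g_ge]; m is raised by the same [k], and by 4 for
   the condition on m there. *)
near=> n.
have : ((m + k + 4).+1%:R : R) <= g (c + k%:R) n.
  apply: g_ge; [lra|exact: leq_addl|].
  by near: n; exact: nbhs_infty_ge.
rewrite /g -!natr1 !natrD; lra.
Unshelve. all: end_near. Qed.

Lemma inv_nat_cvg0 (e : R) : 0 < e -> \forall n \near \oo, expR 1 / n%:R <= e.
Proof.
move=> e0; near=> n.
have nB : expR 1 / e <= n%:R by near: n; exact: nbhs_infty_ger.
have n0 : 0 < n%:R :> R.
  by apply: lt_le_trans nB; rewrite divr_gt0 ?expR_gt0.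
by rewrite ler_pdivrMr // mulrC -ler_pdivrMr.
Unshelve. all: end_near. Qed.

(** For fixed m, eventually m + 1 <= g 0 n, so the error is O(1/n). This proves the convergence
    needed to give the [lim] in [limprob] its intended meaning. *)
Lemma zero_one_law (Phi : sentence) m : (qdepth Phi <= m.+1)%N ->
  exists v : bool, limprob R Phi = v%:R /\
    forall n, (m <= n)%N ->
    `|prob R n Phi - v%:R| <= (2 * n%:R) ^+ m * (1 - 2^-1 ^+ m) ^+ (n - m).
Proof.
move=> dm; have [v Hv] := prob_near_bool R dm; exists v.
have cv : prob R n Phi @[n --> \oo] --> (v%:R : R).
  apply/cvgrPdist_le => e e0; near=> n.
  have gm : m.+1%:R <= g 0 n :> R by near: n; exact: g_near.
  have [mn le1] : (m <= n)%N /\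
      (2 * n%:R) ^+ m * (1 - 2^-1 ^+ m) ^+ (n - m) <= expR 1 / n%:R :> R.
    by move: (m) gm; near: n; apply: extension_failure_small; exact: ltr01.
  rewrite distrC (le_trans (Hv n mn)) // (le_trans le1) //.
  by near: n; exact: inv_nat_cvg0.
by split=> //; exact: cvg_lim cv.
Unshelve. all: end_near. Qed.

Lemma dev_cvg0 c : c < 1 -> dev (g c n) n @[n --> \oo] --> (0 : R).
Proof.
move=> c1; apply/cvgr0Pnorm_le => e e0; near=> n.
have g1 : 1 <= g c n by near: n; exact: (g_near c 0).
have [mem _] := dev_max n g1; case: mem => Phi /= dPhi <-.
rewrite normr_id.
(* m + 1 is the integer part of g c n, the largest depth allowed at n. *)
pose m := (Num.truncn (g c n)).-1.
have g0 : 0 <= g c n by exact: le_trans g1.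
have mE : Num.truncn (g c n) = m.+1.
  by rewrite prednK // truncn_ge_nat.
have dm : (qdepth Phi <= m.+1)%N by rewrite -mE truncn_ge_nat.
have gm : m.+1%:R <= g c n by rewrite -truncn_ge_nat // mE.
have [mn le1] : (m <= n)%N /\
    (2 * n%:R) ^+ m * (1 - 2^-1 ^+ m) ^+ (n - m) <= expR 1 / n%:R :> R.
  (* Since [m] depends on [n], it is generalized before passing to the filter. *)
  by move: (m) gm; near: n; apply: extension_failure_small.
have [v [-> Hv]] := zero_one_law dm.
rewrite (le_trans (Hv n mn)) // (le_trans le1) //.
by near: n; exact: inv_nat_cvg0.
Unshelve. all: end_near. Qed.

End Asymptotics.

(** * The common-neighbour sentence and its change when a vertex is added *)

Section CommonNeighbour.
Import mathcomp.boot.fintype mathcomp.boot.finset Pilot.Defs.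
Local Close Scope classical_set_scope.
Variable R : realType.

Fixpoint forall_closure j : fo j -> sentence :=
  match j with
  | 0 => id
  | j'.+1 => fun f => forall_closure (FAll f)
  end.

(** The tautology [FEq ord0 ord0] is the empty conjunction; variable [ord0] is the neighbour to be
    bound by [FEx]. *)
Definition adj_all j : fo j.+1 :=
  foldr (fun i f => FAnd (FAdj ord0 (lift ord0 i)) f) (FEq ord0 ord0)
    (enum 'I_j).

Definition common_sentence m : sentence := forall_closure (FEx (adj_all m)).

Lemma qdepth_forall_closure j (f : fo j) :
  qdepth (forall_closure f) = (j + qdepth f)%N.
Proof. by elim: j f => //= j IH f; rewrite IH /= addnS. Qed.

Lemma qdepth_common m : qdepth (common_sentence m) = m.+1.
Proof.
rewrite qdepth_forall_closure /= (_ : qdepth _ = 0%N) ?addn1 //.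
by rewrite /adj_all; elim: (enum _) => //= i s ->.
Qed.

Lemma env_cons_eta (T : Type) j (e : 'I_j.+1 -> T) :
  env_cons (e ord0) (e \o lift ord0) = e.
Proof.
by apply/funext=> i; rewrite /env_cons; case: unliftP => [k|] ->.
Qed.

Lemma models_forall_closure (T : finType) (adj : rel T) j (f : fo j) :
  models adj (forall_closure f) <-> forall e : 'I_j -> T, eval adj f e.
Proof.
elim: j f => [|j IH] f; rewrite /models.
  split=> [h e|]; last exact.
  by rewrite (_ : e = @env_nil T) //; apply/funext => -[].
rewrite /= -/(models _ _); split=> [/IH h e|h].
  by rewrite -(env_cons_eta e); exact: (forallP (h (e \o lift ord0))).
by apply/IH => e; apply/forallP => x.
Qed.

Lemma eval_adj_all (T : finType) (adj : rel T) j (x : T) (e : 'I_j -> T) :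
  eval adj (adj_all j) (env_cons x e) = [forall i, adj x (e i)].
Proof.
transitivity (all (fun i => adj x (e i)) (enum 'I_j)); last first.
  apply/allP/forallP=> h i; last by [].
  by apply: h; rewrite mem_enum.
have x0 : env_cons x e ord0 = x.
  by rewrite /env_cons; case: unliftP => // k /eqP; rewrite (negPf (neq_lift _ _)).
rewrite /adj_all; elim: (enum _) => /= [|i s ->]; first by rewrite eqxx.
by rewrite x0 {1}/env_cons liftK.
Qed.

Definition common_nbr (T : finType) (adj : rel T) (S : {set T}) : bool :=
  [exists z, [forall v in S, adj z v]].

(** The quantified vertices may coincide; their set is then enlarged to an m-set, which exists
    because m <= #|T|. *)
Lemma models_common (T : finType) (adj : rel T) m : (m <= #|T|)%N ->
  models adj (common_sentence m) =
  [forall S : {set T}, (#|S| == m) ==> common_nbr adj S].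
Proof.
move=> mT; apply/idP/forallP=> [/models_forall_closure h S|h].
  apply/implyP=> /eqP Sm; subst m.
  have /= /existsP[z] := h (@enum_val _ (mem S)).
  rewrite eval_adj_all => /forallP hz; apply/existsP; exists z.
  apply/forall_inP=> v vS.
  by have := hz (enum_rank_in vS v); rewrite enum_rankK_in.
apply/models_forall_closure => e /=.
have [U eU Um] : exists2 U : {set T}, [set e i | i : 'I_m] \subset U & #|U| = m.
  apply: superset_card; rewrite mT andbT -[X in (_ <= X)%N]card_ord.
  exact: leq_imset_card.
have /existsP[z /forall_inP hz] := implyP (h U) (introT eqP Um).
apply/existsP; exists z; rewrite eval_adj_all; apply/forallP=> i.
by apply/hz/(subsetP eU)/imset_f.
Qed.

Lemma extends_common (T : finType) (adj : rel T) m : (m <= #|T|)%N ->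
  extends m adj -> models adj (common_sentence m).
Proof.
move=> mT ext; rewrite models_common //; apply/forallP=> S; apply/implyP=> /eqP Sm.
move/forallP/(_ S)/implyP: ext; rewrite Sm => /(_ (leqnn m))/forallP/(_ S).
rewrite subxx /= => /existsP[z /andP[_ /eqP zS]]; apply/existsP; exists z.
by apply/forall_inP=> v; rewrite -zS inE => /andP[].
Qed.

Lemma prob_common_ge m n : (m <= n)%N ->
  1 - (2 * n%:R) ^+ m * (1 - 2^-1 ^+ m) ^+ (n - m) <=
  prob R n (common_sentence m).
Proof.
move=> mn; rewrite lerBlDr -lerBlDl; apply: le_trans (avg_not_extends R mn).
rewrite prob_avg -[X in X - _](avg_cst (pairs n)) -avgB; apply: le_avg => G _.
have [/extends_common -> //|_] := boolP (extends _ _).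
  by rewrite subrr.
  by rewrite card_ord.
by rewrite lerBlDr lerDl ler0n.
Qed.

(** If the old graph fails at an m-set S, old vertices still fail there, so only the new vertex can
    repair S, and that takes all m edges from it to S. *)
Lemma prob_common_step m n : (m <= n)%N ->
  prob R n.+1 (common_sentence m) <= prob R n (common_sentence m) + 2^-1 ^+ m.
Proof.
move=> mn; rewrite !prob_avg.
pose z : 'I_n.+1 := ord_max; pose io : 'I_n -> 'I_n.+1 := lift z.
have ioI : injective io by exact: lift_inj.
pose h (e : {set 'I_n}) : {set 'I_n.+1} := io @: e.
have hI : injective h by exact: imset_inj.
pose W := io @: [set: 'I_n]; pose st (v : 'I_n.+1) := [set z; v].
have stI : injective st by exact: set2_inj.
have zh e : z \notin h e.
  by apply/negP=> /imsetP[i _ /eqP]; rewrite (negPf (neq_lift _ _)).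
have ioP v : v != z -> exists i, v = io i.
  by rewrite eq_sym => /unlift_some[i -> _]; exists i.
have PE : pairs n.+1 = h @: pairs n :|: st @: W.
  apply/setP=> e; rewrite inE in_setU.
  apply/idP/orP=> [e2|[/imsetP[e' + ->]|/imsetP[_ /imsetP[i _ ->] ->]]].
  - have [ze|ze] := boolP (z \in e); [right|left].
      have /cards1P[v ev] : #|e :\ z| == 1%N.
        by move: e2; rewrite (cardsD1 z e) ze.
      have /setD1P[vz _] : v \in e :\ z by rewrite ev inE.
      have [i vi] := ioP _ vz.
      apply/imsetP; exists v; first by rewrite vi imset_f.
      by rewrite /st -ev setD1K.
    have ee : e = h (io @^-1: e).
      apply/setP=> v; apply/idP/imsetP=> [ve|[i + ->]]; last by rewrite inE.
      have [i vi] : exists i, v = io i by apply: ioP; apply: contraNneq ze => <-.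
      by exists i; rewrite // inE -vi.
    apply/imsetP; exists (io @^-1: e) => //.
    by rewrite inE -(card_imset _ ioI) -/(h _) -ee.
  - by rewrite inE /h card_imset.
  - by rewrite cards2 neq_lift.
have dE : [disjoint h @: pairs n & st @: W].
  rewrite -setI_eq0; apply/eqP/setP=> e; rewrite !inE; apply/andP.
  move=> [/imsetP[e' _ ->] /imsetP[v _ /setP/(_ z)]].
  by rewrite !inE eqxx (negPf (zh _)).
(* Conditioning on the old graph [A]; the star [B] of the new vertex is averaged afterwards. *)
rewrite PE avgU // avg_imset // -[2^-1 ^+ m](avg_cst (pairs n)) -avgD.
apply: le_avg => A AP; rewrite avg_imset //.
have [mA|mA] := boolP (models (adjacent A) _).
  rewrite ler_wpDr ?exprn_ge0 ?invr_ge0 ?ler0n // -[X in _ <= X](avg_cst W).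
  by apply: le_avg => B _; rewrite ler_nat leq_b1.
rewrite add0r; move: mA; rewrite models_common ?card_ord // negb_forall.
move=> /existsP[S]; rewrite negb_imply => /andP[/eqP Sm /existsPn nS].
have SW : h S \subset W by apply: imsetS; exact: subsetT.
rewrite -[X in _ ^+ X]Sm -(card_imset (mem S) ioI) -(avg_superset R SW).
apply: le_avg => B BW.
rewrite ler_nat models_common ?card_ord ?(leqW mn) //.
case: forallP => // /(_ (h S)); rewrite /h card_imset // Sm eqxx /= -/(h S).
move=> /existsP[w /forall_inP hw].
have [wz|/ioP[w' ww]] := eqVneq w z; last first.
  have /forall_inPn[v vS] := nS w'; rewrite /adjacent => nv.
  have := hw (io v) (imset_f _ vS); rewrite /adjacent ww.
  have -> : [set io w'; io v] = h [set w'; v] by rewrite /h imsetU1 imset_set1.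
  rewrite in_setU mem_imset // (negPf nv) /= => /imsetP[x _ /setP/(_ z)].
  by rewrite (negPf (zh _)) !inE eqxx.
rewrite (_ : _ \subset _) //; apply/subsetP=> v vS.
have := hw v vS; rewrite /adjacent wz in_setU => /orP[/imsetP[e _ /setP/(_ z)]|].
  by rewrite (negPf (zh _)) !inE eqxx.
by rewrite -/(st v) mem_imset.
Qed.

End CommonNeighbour.

(** * Second moment method for transversals without common neighbour *)

Section SecondMoment.
Import mathcomp.boot.fintype mathcomp.boot.finset Pilot.Defs.
Local Close Scope classical_set_scope.
Variable R : realType.

(** Chebyshev at zero, in a division-free form: (X - mu)^2 is at least mu^2 where X vanishes. *)
Lemma avg_second_moment (T : finType) (E : {set T}) (X : {set T} -> R) :
  avg E (fun G => (X G == 0)%:R) * avg E X ^+ 2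
  <= avg E (fun G => X G ^+ 2) - avg E X ^+ 2.
Proof.
set mu := avg E X; rewrite mulrC -avgZ.
apply: (@le_trans _ _ (avg E (fun G => X G ^+ 2 - 2 * mu * X G + mu ^+ 2))).
  apply: le_avg => G _; have -> : X G ^+ 2 - 2 * mu * X G + mu ^+ 2 =
    (X G - mu) ^+ 2 by ring.
  case: eqP => [->|_]; first by rewrite mulr1 sub0r sqrrN.
  by rewrite mulr0 sqr_ge0.
by rewrite avgD avgB avgZ avg_cst -/mu; lra.
Qed.

Lemma common_nbrN n (G : {set {set 'I_n}}) (S V : {set 'I_n}) : S \subset V ->
  ~~ common_nbr (adjacent G) S ->
  [forall z in ~: V, ~~ (S \subset trace (adjacent G) z V)].
Proof.
move=> SV /existsPn h; apply/forall_inP=> z _; apply: contra (h z) => /subsetP sub.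
by apply/forall_inP=> v /sub; rewrite inE => /andP[].
Qed.

(** Exact, because irreflexivity keeps vertices of S from being common neighbours of S. *)
Lemma avg_no_common n (S : {set 'I_n}) : (0 < #|S|)%N ->
  avg (pairs n) (fun G => (~~ common_nbr (adjacent G) S)%:R)
  = (1 - 2^-1 ^+ #|S|) ^+ (n - #|S|) :> R.
Proof.
move=> S0.
rewrite (@eq_avg _ _ _ _ (fun G =>
    [forall z in ~: S, ~~ (S \subset trace (adjacent G) z S)]%:R)).
  rewrite (@avg_traces _ n S (~: S) (fun B => ~~ (S \subset B))).
    rewrite cardsCs setCK card_ord; congr (_ ^+ _).
    rewrite -(avg_superset R (subxx S)) -[X in X - _](avg_cst S) -avgB.
    by apply: eq_avg => B _; case: (S \subset B); rewrite ?subrr ?subr0.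
  by rewrite -setI_eq0 setIC setICr.
move=> G GP; congr (nat_of_bool _)%:R; apply/idP/idP; first exact: common_nbrN.
move=> /forall_inP h; apply/existsPn=> z; apply/negP=> /forall_inP hz.
have [zS|zS] := boolP (z \in S).
  by have := hz z zS; rewrite adjacent_irr.
have /h /negP[] : z \in ~: S by rewrite inE.
by apply/subsetP=> v vS; rewrite inE vS hz.
Qed.

(** Only vertices outside the union are tested, hence an inequality; the base is inclusion-exclusion
    for one trace. *)
Lemma avg_no_common2 n (S S' : {set 'I_n}) :
  avg (pairs n) (fun G => (~~ common_nbr (adjacent G) S)%:R *
                          (~~ common_nbr (adjacent G) S')%:R)
  <= (1 - 2^-1 ^+ #|S| - 2^-1 ^+ #|S'| + 2^-1 ^+ #|S :|: S'|)
       ^+ (n - #|S :|: S'|) :> R.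
Proof.
set V := S :|: S'.
have SV : S \subset V by exact: subsetUl.
have SV' : S' \subset V by exact: subsetUr.
apply: (@le_trans _ _ (avg (pairs n) (fun G => [forall z in ~: V,
    ~~ (S \subset trace (adjacent G) z V) &&
    ~~ (S' \subset trace (adjacent G) z V)]%:R))).
  apply: le_avg => G _; rewrite -natrM mulnb ler_nat.
  case: (boolP (_ && _)) => // /andP[/(common_nbrN SV)/forall_inP h].
  move=> /(common_nbrN SV')/forall_inP h'.
  have -> // : [forall z in ~: V, ~~ (S \subset trace (adjacent G) z V) &&
    ~~ (S' \subset trace (adjacent G) z V)].
  by apply/forall_inP=> z zV; rewrite h // h'.
rewrite (@avg_traces _ n V (~: V)
  (fun B => ~~ (S \subset B) && ~~ (S' \subset B))).
  rewrite cardsCs setCK card_ord.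
  rewrite -(avg_superset R SV) -(avg_superset R SV') -(avg_superset R (subxx V)).
  rewrite -[X in X - _ - _ + _](avg_cst V) -!avgB -avgD.
  rewrite le_eqVlt; apply/orP; left; apply/eqP; congr (_ ^+ _).
  apply: eq_avg => B BV; rewrite subUset.
  by case: (S \subset B); case: (S' \subset B) => /=; lra.
by rewrite -setI_eq0 setIC setICr.
Qed.

(* Choosing one vertex per block turns the sum over pairs of transversals into a
   product over the blocks. *)
Lemma sum_pow_agree (w : R) m b :
  \sum_(f : {ffun 'I_m -> 'I_b}) \sum_(f' : {ffun 'I_m -> 'I_b})
     w ^+ #|[set i | f i == f' i]|
  = b%:R ^+ m * (b%:R - 1 + w) ^+ m.
Proof.
rewrite (eq_bigr (fun=> (b%:R - 1 + w) ^+ m)).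
  by rewrite sumr_const card_ffun !card_ord -[_ *+ _]mulr_natl natrX.
move=> f _; transitivity (\prod_(i < m) \sum_(a < b) w ^+ (f i == a)).
  rewrite bigA_distr_bigA; apply: eq_bigr => f' _.
  rewrite -prodr_const big_mkcond; apply: eq_bigr => i _.
  by rewrite inE; case: eqP.
rewrite (eq_bigr (fun=> b%:R - 1 + w)) ?prodr_const ?card_ord // => i _.
rewrite (bigD1 (f i)) //= eqxx expr1 addrC; congr (_ + _).
rewrite (eq_bigr (fun=> 1)) => [|a /negPf]; last first.
  by rewrite eq_sym => ->.
rewrite sumr_const cardC1 card_ord; case: b f => [|b] f.
  by case: (f i).
by rewrite -natr1 addrK.
Qed.

(* Convexity of j |-> 2^j. *)
Lemma chord_pow2 m j : (j <= m)%N -> (m * (2 ^ j - 1) <= j * (2 ^ m - 1))%N.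
Proof.
elim: m => [|m IH]; first by rewrite leqn0 => /eqP ->.
rewrite leq_eqVlt => /orP[/eqP -> //|]; rewrite ltnS => jm.
have := IH jm; have : (2 ^ j <= 2 ^ m)%N by rewrite leq_exp2l.
have : (0 < 2 ^ j)%N by rewrite expn_gt0.
by rewrite [(2 ^ m.+1)%N]expnS; case: j jm {IH} => [|j] jm; nia.
Qed.

(* j is the overlap of two transversals: each shared vertex costs a factor at
   most e^(m/4), far below the block size 2^(m-3) used later. *)
Lemma second_moment_term m n j (q := 2^-1 ^+ m : R) :
  (2 <= m)%N -> (j <= m)%N -> 8 * n%:R * q <= m%:R ^+ 2 ->
  0 <= 1 - 2 * q + q ^+ 2 * 2 ^+ j <= 1 /\
  (1 - 2 * q + q ^+ 2 * 2 ^+ j) ^+ n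
    <= (1 - q) ^+ (2 * n) * expR (m%:R / 4) ^+ j.
Proof.
move=> m2 jm nq.
have q0 : 0 < q by rewrite exprn_gt0 // invr_gt0 ltr0n.
have q4 : q <= 4^-1.
  rewrite /q -(subnKC m2) exprD.
  have -> : (2^-1 ^+ 2 : R) = 4^-1 by field.
  rewrite ler_piMr ?invr_ge0 ?ler0n // exprn_ile1 ?invr_ge0 ?ler0n //.
  by rewrite invf_le1 ?ltr0n // ler1n.
have q2m : q * 2 ^+ m = 1 by rewrite /q exprVn mulVf // expf_neq0 // pnatr_eq0.
have j1 : 1 <= 2 ^+ j :> R by rewrite exprn_ege1 // ler1n.
have jle : 2 ^+ j <= 2 ^+ m :> R by rewrite ler_eXn2l // ltr1n.
have qj : q * 2 ^+ j <= 1 by rewrite -[X in _ <= X]q2m ler_pM2l.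
have qqj : q ^+ 2 * 2 ^+ j <= q by rewrite expr2 -mulrA ler_piMr // ltW.
have qqj0 : 0 <= q ^+ 2 * (2 ^+ j - 1).
  by apply: mulr_ge0; rewrite ?sqr_ge0 ?subr_ge0.
have qq : 0 <= q ^+ 2 by rewrite sqr_ge0.
split; first by apply/andP; split; nra.
have chord : m%:R * (2 ^+ j - 1) <= j%:R * 2 ^+ m :> R.
  have := chord_pow2 jm; rewrite -(ler_nat R) !natrM !natrB ?expn_gt0 // !natrX.
  by move/le_trans; apply; rewrite ler_wpM2l // gerBl ler01.
(* The left side is (1 - q)^2 + q^2 (2^j - 1), and q <= 1/4 gives (1 - q)^2 >= 1/2, whence the
   factor 2 in the exponent. *)
have e1 : 1 - 2 * q + q ^+ 2 * 2 ^+ j <=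
    (1 - q) ^+ 2 * expR (2 * (q ^+ 2 * (2 ^+ j - 1))).
  have := expR_ge1Dx (2 * (q ^+ 2 * (2 ^+ j - 1))); set E := expR _ => hE.
  have q12 : 2^-1 <= (1 - q) ^+ 2 by nra.
  have : (1 - q) ^+ 2 * (1 + 2 * (q ^+ 2 * (2 ^+ j - 1))) <= (1 - q) ^+ 2 * E.
    by rewrite ler_wpM2l // sqr_ge0.
  apply: le_trans.
  have : 2^-1 * (q ^+ 2 * (2 ^+ j - 1)) <= (1 - q) ^+ 2 * (q ^+ 2 * (2 ^+ j - 1)).
    by rewrite ler_wpM2r.
  by nra.
apply: le_trans (_ : ((1 - q) ^+ 2 * expR (2 * (q ^+ 2 * (2 ^+ j - 1)))) ^+ n <= _).
  by apply: lerXn2r => //; rewrite nnegrE ?mulr_ge0 ?sqr_ge0 ?expR_ge0 //; nra.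
rewrite exprMn -exprM ler_wpM2l ?exprn_ge0 //; first by lra.
rewrite -!expRM_natl ler_expR.
have m0 : 0 < m%:R :> R by rewrite ltr0n (leq_trans _ m2).
(* The chord bound makes the exponent linear in j, as the product over blocks requires. *)
have h1 : q * (m%:R * (2 ^+ j - 1)) <= j%:R.
  apply: le_trans (_ : q * (j%:R * 2 ^+ m) <= _); first by rewrite ler_pM2l.
  by rewrite mulrCA q2m mulr1.
have h2 : 8 * n%:R * q * (q * (2 ^+ j - 1)) <= m%:R ^+ 2 * (q * (2 ^+ j - 1)).
  by rewrite ler_wpM2r // mulr_ge0 ?subr_ge0 // ltW.
have h3 : m%:R * (q * (m%:R * (2 ^+ j - 1))) <= m%:R * j%:R.
  by rewrite ler_pM2l.
have -> : n%:R * (2 * (q ^+ 2 * (2 ^+ j - 1))) =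
  8 * n%:R * q * (q * (2 ^+ j - 1)) / 4 :> R by field.
have -> : j%:R * (m%:R / 4) = m%:R * j%:R / 4 :> R by field.
rewrite ler_pM2r ?invr_gt0 ?ltr0n // (le_trans h2) //.
by apply: le_trans h3; rewrite expr2 -!mulrA [q * (m%:R * _)]mulrCA.
Qed.

(** [h (i, a)] is vertex a of block i, [S f] the transversal chosen by [f], and [X] counts the
    transversals without common neighbour. The sentence forces X = 0, and the right side bounds
    E[X^2] / E[X]^2 - 1. *)
Lemma prob_common_second_moment m n b (q := 2^-1 ^+ m : R) :
  (2 <= m)%N -> (0 < b)%N -> (m * b <= n)%N -> (2 * m <= n)%N ->
  8 * n%:R * q <= m%:R ^+ 2 ->
  prob R n (common_sentence m) <=
  ((b%:R - 1 + expR (m%:R / 4)) / b%:R) ^+ m / (1 - q) ^+ (2 * m) - 1.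
Proof.
move=> m2 b0 mbn mn nq.
have cI : (#|{: 'I_m * 'I_b}| <= n)%N by rewrite card_prod !card_ord.
pose h (p : 'I_m * 'I_b) : 'I_n := widen_ord cI (enum_rank p).
have hI : injective h.
  by move=> p p' /(congr1 val) /= /val_inj /enum_rank_inj.
pose S (f : {ffun 'I_m -> 'I_b}) : {set 'I_n} := [set h (i, f i) | i : 'I_m].
have Sin f i a : (h (i, a) \in S f) = (f i == a).
  apply/imsetP/eqP=> [[i' _ /hI[-> ->]] //|<-].
  by exists i.
have Sm f : #|S f| = m.
  rewrite card_imset ?card_ord //.
  by move=> i i' /hI[].
have SI f f' : #|S f :&: S f'| = #|[set i | f i == f' i]|.
  rewrite -(card_imset (mem [set i | f i == f' i]) (f := fun i => h (i, f i))).
    apply: eq_card => v; rewrite inE; apply/andP/imsetP.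
      move=> [/imsetP[i _ ->]]; rewrite Sin => ff; exists i => //.
      by rewrite inE eq_sym.
    by move=> [i + ->]; rewrite !inE !Sin eqxx eq_sym.
  by move=> i i' /hI[].
pose bad f (G : {set {set 'I_n}}) : R := (~~ common_nbr (adjacent G) (S f))%:R.
pose X (G : {set {set 'I_n}}) : R := \sum_f bad f G.
have q0 : 0 < q by rewrite exprn_gt0 // invr_gt0 ltr0n.
have q2 : q <= 2^-1.
  rewrite /q -(subnKC (ltnW m2)) exprD expr1.
  rewrite ler_piMr ?invr_ge0 ?ler0n // exprn_ile1 ?invr_ge0 ?ler0n //.
  by rewrite invf_le1 ?ltr0n // ler1n.
have q10 : 0 < 1 - q by lra.
have EX : avg (pairs n) X = b%:R ^+ m * (1 - q) ^+ (n - m).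
  rewrite avg_sum (eq_bigr (fun=> (1 - q) ^+ (n - m))) => [|f _].
    by rewrite sumr_const card_ffun !card_ord -[_ *+ _]mulr_natl natrX.
  by rewrite avg_no_common Sm // (leq_trans _ m2).
set w : R := expR (m%:R / 4).
have EX2 : avg (pairs n) (fun G => X G ^+ 2) <=
    (1 - q) ^+ (2 * (n - 2 * m)) * (b%:R ^+ m * (b%:R - 1 + w) ^+ m).
  rewrite -sum_pow_agree mulr_sumr.
  rewrite (@eq_avg _ _ _ _ (fun G => \sum_f \sum_f' bad f G * bad f' G)); last first.
    move=> G _; rewrite expr2 /X mulr_suml; apply: eq_bigr => f _.
    by rewrite mulr_sumr.
  rewrite avg_sum; apply: ler_sum => f _; rewrite avg_sum mulr_sumr.
  apply: ler_sum => f' _; apply: le_trans (avg_no_common2 _ _) _.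
  set j := #|[set i | f i == f' i]|.
  have jm : (j <= m)%N by rewrite -[m in (_ <= m)%N]card_ord max_card.
  have Vc : #|S f :|: S f'| = (2 * m - j)%N by rewrite cardsU !Sm SI mul2n addnn.
  rewrite !Sm Vc -/q.
  have -> : (2^-1 ^+ (2 * m - j) : R) = q ^+ 2 * 2 ^+ j.
    rewrite /q -exprM [(m * 2)%N]mulnC -{2}(@subnK j (2 * m)); last first.
      by rewrite (leq_trans jm) // leq_pmull.
    rewrite exprD -mulrA -exprMn mulVf ?pnatr_eq0 // expr1n mulr1 //.
  have -> : 1 - q - q + q ^+ 2 * 2 ^+ j = 1 - 2 * q + q ^+ 2 * 2 ^+ j by ring.
  (* The exponent n - (2m - j) is lowered to n - 2m, making it the same for all overlaps j. *)
  have nq' : 8 * (n - 2 * m)%:R * q <= m%:R ^+ 2.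
    apply: le_trans nq; rewrite ler_pM2r // ler_pM2l ?ltr0n // ler_nat.
    exact: leq_subr.
  have [/andP[t0 t1] tle] := second_moment_term m2 jm nq'.
  apply: le_trans tle; apply: ler_wiXn2l => //.
  by apply: leq_sub2l; exact: leq_subr.
have b0R : 0 < b%:R :> R by rewrite ltr0n.
have EX0 : 0 < avg (pairs n) X by rewrite EX mulr_gt0 ?exprn_gt0.
have P0 : prob R n (common_sentence m) <=
    avg (pairs n) (fun G => (X G == 0)%:R).
  rewrite prob_avg; apply: le_avg => G _.
  rewrite models_common ?card_ord; last first.
    by rewrite (leq_trans _ mn) // leq_pmull.
  rewrite ler_nat; case: forallP => // H.
  rewrite (_ : X G == 0) //; apply/eqP; rewrite /X big1 // => f _.
  by have := H (S f); rewrite Sm eqxx /bad /= => ->.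
apply: le_trans P0 _.
have := avg_second_moment (pairs n) X.
rewrite -ler_pdivlMr ?exprn_gt0 // => /le_trans; apply.
rewrite mulrBl divff ?expf_neq0 ?gt_eqF // lerB //.
rewrite ler_pdivrMr ?exprn_gt0 // (le_trans EX2) // EX.
rewrite le_eqVlt; apply/orP; left; apply/eqP.
have -> : (2 * (n - 2 * m) = 2 * (n - m) - 2 * m)%N by rewrite !mulnBr !mul2n -!addnn subnDA.
have e1 : (1 - q) ^+ (2 * (n - m)) = (1 - q) ^+ (2 * (n - m) - 2 * m) * (1 - q) ^+ (2 * m).
  rewrite -exprD subnK // leq_mul2l /= leq_subRL; last by rewrite (leq_trans _ mn) // leq_pmull.
  by rewrite addnn -mul2n.
rewrite expr_div_n exprMn -[(_ ^+ (n - m)) ^+ 2]exprM [((n - m) * 2)%N]mulnC e1.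
have bn0 : b%:R ^+ m != 0 :> R by rewrite expf_neq0 // gt_eqF.
have qn0 : (1 - q) ^+ (2 * m) != 0 by rewrite expf_neq0 // gt_eqF.
move: bn0 qn0; move: (b%:R ^+ m) ((1 - q) ^+ (2 * m)) => B Q B0 Q0.
move: ((1 - q) ^+ _) ((_ + _) ^+ m) => Q' W.
by field; rewrite B0 Q0.
Qed.

End SecondMoment.

(** * Approximating every probability, and failure of convergence for c >= 6 *)

Section Interpolation.
Variable R : realType.

Lemma sqr_le_geometric m : m%:R ^+ 2 <= 18 * (3 / 2) ^+ m :> R.
Proof.
have [m5|] := ltnP m 5.
  by do 5?[case: m m5 => [|m] //= m5]; rewrite ?expr0; lra.
elim: m => // m IH; rewrite leq_eqVlt => /orP[/eqP <-|].
  by rewrite !exprS expr0; lra.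
(* (m + 1)^2 <= (3/2) m^2 holds from m = 5 on, but not at m = 4. *)
rewrite ltnS => m5; have {}IH := IH m5; rewrite [(3 / 2) ^+ m.+1]exprS -[m.+1%:R]natr1.
have : 5 <= m%:R :> R by rewrite ler_nat.
by move: IH; set X := (3 / 2) ^+ m; set Y := m%:R => IH Y5; nra.
Qed.

(** With blocks of size b = 2^(m-3), 8 n q is exactly m^2. As e^(1/4) <= 4/3, both q and w / b are
    O(u) for u = (2/3)^m, so the second moment ratio is at most exp (12 m u). *)
Lemma prob_common_start m : (432 <= m)%N ->
  prob R (m ^ 2 * 2 ^ (m - 3)) (common_sentence m) <= 432 / m%:R.
Proof.
move=> m432; set n := (m ^ 2 * 2 ^ (m - 3))%N; set b := (2 ^ (m - 3))%N.
have m3 : (3 <= m)%N by exact: leq_trans m432.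
have mpos : (0 < m)%N by exact: leq_trans m3.
have b0 : (0 < b)%N by rewrite expn_gt0.
have mR : 432 <= m%:R :> R by rewrite ler_nat.
set q : R := 2^-1 ^+ m.
have bq : 8 * b%:R * q = 1.
  rewrite /b natrX /q exprVn -[in X in _ / X](subnKC m3) exprD.
  have : 2 ^+ (m - 3) != 0 :> R by rewrite expf_neq0 // pnatr_eq0.
  by move: (2 ^+ (m - 3)) => B B0; field.
have nq : 8 * n%:R * q <= m%:R ^+ 2.
  have -> : n%:R = m%:R ^+ 2 * b%:R :> R by rewrite natrM natrX.
  by rewrite mulrCA -mulrA bq mulr1.
have mbn : (m * b <= n)%N by rewrite leq_mul2r leq_pmulr ?orbT.
have mmn : (2 * m <= n)%N.
  rewrite (@leq_trans (m ^ 2)) ?leq_pmulr //.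
  by rewrite -mulnn leq_mul2r (leq_trans _ m3) ?orbT.
have := prob_common_second_moment (leq_trans (isT : 1 < 3)%N m3) b0 mbn mmn nq.
move/le_trans; apply; rewrite -/q.
set w : R := expR _.
have b0R : 0 < b%:R :> R by rewrite ltr0n.
have m0 : 0 < m%:R :> R by rewrite ltr0n.
pose u : R := (2 / 3) ^+ m.
have u0 : 0 < u by rewrite exprn_gt0 // divr_gt0 ?ltr0n.
have q0 : 0 < q by rewrite exprn_gt0 // invr_gt0 ltr0n.
have qu : q <= u by apply: lerXn2r; rewrite ?nnegrE; lra.
have q2 : q <= 2^-1.
  rewrite /q -(subnKC mpos) exprD expr1.
  rewrite ler_piMr ?invr_ge0 ?ler0n // exprn_ile1 ?invr_ge0 ?ler0n //.
  by rewrite invf_le1 ?ltr0n // ler1n.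
have wle : w <= (4 / 3) ^+ m.
  rewrite /w expRM_natl; apply: lerXn2r; rewrite ?nnegrE ?expR_ge0 ?divr_ge0 ?ler0n //.
  have := expR_ge1Dx (- 4^-1 : R); rewrite expRN => h.
  by rewrite -[expR _]invrK invf_ple ?posrE ?invr_gt0 ?expR_gt0 ?invf_div //; lra.
have wb : w / b%:R <= 8 * u.
  have -> : b%:R^-1 = 8 * q.
    by apply: (mulfI (lt0r_neq0 b0R)); rewrite divff ?lt0r_neq0 // mulrCA mulrA bq.
  rewrite mulrCA ler_pM2l ?ltr0n //.
  have -> : u = (4 / 3) ^+ m * q.
    by rewrite /u /q -exprMn; congr (_ ^+ _); field.
  by rewrite ler_pM2r.
have um : u * m%:R ^+ 2 <= 18.
  have := sqr_le_geometric m.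
  have u32 : u * (3 / 2) ^+ m = 1.
    by rewrite /u -exprMn (_ : 2 / 3 * (3 / 2) = 1) ?expr1n //; field.
  by rewrite -(ler_pM2l u0) [u * (18 * _)]mulrCA u32 mulr1.
(* 216 is 12 * 18, with 12 = 8 + 4 from [e1] and [e2] and 18 from [um]. The condition m >= 432 gives
   x <= 1/2, so e^x - 1 <= 2x = 432 / m. *)
pose x : R := 216 / m%:R.
have x0 : 0 < x by rewrite divr_gt0 ?ltr0n.
have x2 : x <= 2^-1 by rewrite ler_pdivrMr //; lra.
have mu : 12 * (m%:R * u) <= x.
  by rewrite ler_pdivlMr //; move: um; rewrite expr2; lra.
have e1 : ((b%:R - 1 + w) / b%:R) ^+ m <= expR (m%:R * (8 * u)).
  rewrite expRM_natl; apply: lerXn2r; rewrite ?nnegrE ?expR_ge0 //.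
    rewrite divr_ge0 ?ler0n // addr_ge0 ?expR_ge0 // subr_ge0 ler1n //.
  apply: le_trans (expR_ge1Dx _); apply: le_trans (lerD (lexx 1) wb).
  rewrite mulrDl lerD2r ler_pdivrMr // mul1r.
  by rewrite gerBl ler01.
have e2 : ((1 - q) ^+ (2 * m))^-1 <= expR (m%:R * (4 * u)).
  have -> : m%:R * (4 * u) = (2 * m)%:R * (2 * u) by rewrite natrM; ring.
  rewrite expRM_natl -exprVn; apply: lerXn2r; rewrite ?nnegrE ?expR_ge0 //.
    by rewrite invr_ge0; lra.
  apply: (@le_trans _ _ (1 + 2 * q)).
    by rewrite -[X in X <= _]mul1r ler_pdivrMr; nra.
  by apply: le_trans (expR_ge1Dx _); lra.
have -> : 432 / m%:R = 2 * x by rewrite /x; field; rewrite gt_eqF.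
rewrite lerBlDr.
apply: (@le_trans _ _ (expR x)).
  apply: (@le_trans _ _ (expR (m%:R * (8 * u)) * expR (m%:R * (4 * u)))).
    apply: ler_pM => //.
      rewrite exprn_ge0 // divr_ge0 ?ler0n // addr_ge0 ?expR_ge0 //.
      by rewrite subr_ge0 ler1n.
    by rewrite invr_ge0 exprn_ge0 //; lra.
  by rewrite -expRD ler_expR; move: mu; lra.
have h := expR_ge1Dx (- x); rewrite expRN in h.
have x10 : 0 < 1 - x by lra.
apply: (@le_trans _ _ (1 - x)^-1).
  by rewrite -[expR x]invrK lef_pV2 ?posrE ?invr_gt0 ?expR_gt0.
by rewrite -[X in X <= _]mul1r ler_pdivrMr //; nra.
Qed.

Lemma prob_common_cvg1 m (e : R) : 0 < e ->
  \forall n \near \oo, 1 - e <= prob R n (common_sentence m).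
Proof.
move=> e0; near=> n.
have gm : m.+1%:R <= g 0 n :> R by near: n; exact: g_near.
have [mn le1] : (m <= n)%N /\
    (2 * n%:R) ^+ m * (1 - 2^-1 ^+ m) ^+ (n - m) <= expR 1 / n%:R :> R.
  by move: (m) gm; near: n; apply: extension_failure_small; exact: ltr01.
apply: le_trans (prob_common_ge R mn); rewrite lerD2l lerN2 (le_trans le1) //.
by near: n; exact: inv_nat_cvg0.
Unshelve. all: end_near. Qed.

(** Discrete intermediate value argument in n for one large m: the probability starts below e, comes
    within e of 1, and rises by at most 2^-m <= e per step. *)
Lemma prob_interpolation (c gamma e : R) (l : nat) :
  6 <= c -> 0 <= gamma <= 1 -> 0 < e ->
  exists p : nat * sentence,
    [/\ (l < p.1)%N, (qdepth p.2)%:R <= g c p.1 & `|gamma - prob R p.1 p.2| <= e].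
Proof.
move=> c6 /andP[gam0 gam1] e0.
have [m [m432 lm me]] : exists m, [/\ (432 <= m)%N, (l < m)%N & 432 / m%:R <= e].
  pose k := Num.bound (432 / e).
  have k0 : 432 / e < k%:R.
    by apply: archi_boundP; apply: divr_ge0; [exact: ler0n | exact: ltW].
  exists (k + l.+1 + 432)%N; split; first exact: leq_addl.
    by rewrite -addnA addnC -addnA addSn ltnS leq_addr.
  rewrite ler_pdivrMr ?ltr0n ?addn_gt0 ?orbT // mulrC -ler_pdivrMr //.
  by rewrite (le_trans (ltW k0)) // ler_nat -addnA leq_addr.
have mpos : (0 < m)%N by exact: leq_trans m432.
have m4 : (4 <= m)%N by exact: leq_trans m432.
have m0 : 0 < m%:R :> R by rewrite ltr0n.
pose n0 := (m ^ 2 * 2 ^ (m - 3))%N.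
have mn0 : (m <= n0)%N.
  by rewrite (@leq_trans (m ^ 2)) ?leq_pmulr ?expn_gt0 // -mulnn leq_pmulr.
have start : prob R n0 (common_sentence m) <= e.
  exact: le_trans (prob_common_start m432) me.
have qe : 2^-1 ^+ m <= e.
  apply: le_trans me; rewrite exprVn; apply: (@le_trans _ _ m%:R^-1).
    by rewrite lef_pV2 ?posrE ?exprn_gt0 ?ltr0n // -natrX ler_nat ltnW // ltn_expl.
  by rewrite ler_peMl ?invr_ge0 ?ler0n // ler1n.
pose P n := (n0 <= n)%N && (gamma - e <= prob R n (common_sentence m)).
have exP : exists n, P n.
  have [N _ HN] : \forall n \near \oo, 1 - e <= prob R n (common_sentence m).
    exact: prob_common_cvg1.
  exists (maxn N n0); rewrite /P leq_maxr /=.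
  by apply: le_trans (HN _ (leq_maxl _ _)); rewrite lerD2r.
case: (ex_minnP exP) => n /andP[n0n lo] nmin.
exists (n, common_sentence m) => /=; split.
- exact: leq_trans lm (leq_trans mn0 n0n).
- by rewrite qdepth_common; exact: g_ge.
rewrite ler_norml; apply/andP; split; last by lra.
(* At the least such n, either n = n0, where the probability is at most e, or n - 1 is still below
   gamma - e and one step cannot overshoot gamma. *)
move: n0n; rewrite leq_eqVlt => /orP[/eqP <-|]; first by lra.
case: n lo nmin => // n lo nmin; rewrite ltnS => n0n.
have : ~~ P n by apply/negP=> /nmin; rewrite ltnn.
rewrite /P n0n /= -ltNge => hi.
have := prob_common_step R (leq_trans mn0 n0n).
by lra.
Qed.

Lemma prob_ge0 n (Phi : sentence) : 0 <= prob R n Phi.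
Proof.
rewrite prob_avg -[X in X <= _](avg_cst (pairs n)).
by apply: le_avg => G _; exact: ler0n.
Qed.

Lemma prob_le1 n (Phi : sentence) : prob R n Phi <= 1.
Proof.
rewrite prob_avg -[X in _ <= X](avg_cst (pairs n)); apply: le_avg => G _.
by rewrite lern1 leq_b1.
Qed.

(** The supremum is over a set bounded by 1, as limits are 0 or 1 and probabilities lie in
    [0, 1]. *)
Lemma dev_ge (k : R) n (Phi : sentence) : (qdepth Phi)%:R <= k ->
  `|prob R n Phi - limprob R Phi| <= dev k n.
Proof.
move=> dk; apply: ub_le_sup; last by exists Phi.
exists 1 => _ [Psi _ <-].
have [v [-> _]] := @zero_one_law R Psi (qdepth Psi) (leqnSn _).
have := prob_ge0 n Psi; have := prob_le1 n Psi.
by case: v; rewrite ler_norml => *; apply/andP; split => /=; lra.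
Qed.

Lemma prob_sequence (c gamma : R) : 6 <= c -> 0 <= gamma <= 1 ->
  exists (N : nat -> nat) (Phi : nat -> sentence),
    [/\ (forall i, (1 < N i)%N),
        (forall i j, (i < j)%N -> (N i < N j)%N),
        (forall i, (qdepth (Phi i))%:R <= g c (N i)) &
        prob R (N i) (Phi i) @[i --> \oo] --> gamma].
Proof.
move=> c6 gam.
have [F HF] : {F : nat * nat -> nat * sentence & forall x,
    [/\ (x.1 < (F x).1)%N, (qdepth (F x).2)%:R <= g c (F x).1 &
        `|gamma - prob R (F x).1 (F x).2| <= x.2.+1%:R^-1]}.
  apply: (@boolp.choice _ _ (fun x p => [/\ (x.1 < p.1)%N,
    (qdepth p.2)%:R <= g c p.1 & `|gamma - prob R p.1 p.2| <= x.2.+1%:R^-1])).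
  by move=> x; apply: prob_interpolation; rewrite // invr_gt0 ltr0n.
(* Each stage passes on the previous order as lower bound and its own index as precision; the
   initial bound 1 makes every order exceed 1. *)
pose s := fix s i := if i is j.+1 then F ((s j).1, i) else F (1%N, 0%N).
have sE i : exists l, s i = F (l, i) /\ (0 < l)%N /\ (0 < (s i).1)%N.
  elim: i => [|i [l [_ [_ IH]]]] /=.
    by exists 1%N; have [/= h _ _] := HF (1%N, 0%N); rewrite (leq_trans _ h).
  exists (s i).1; split=> //; split=> //.
  by have [/= h _ _] := HF ((s i).1, i.+1); rewrite (leq_trans _ h).
have sS i : ((s i).1 < (s i.+1).1)%N by case: (HF ((s i).1, i.+1)).
exists (fun i => (s i).1), (fun i => (s i).2); split.
- move=> i; have [l [-> [l0 _]]] := sE i.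
  by have [/= h _ _] := HF (l, i); rewrite (leq_ltn_trans l0 h).
- move=> i j; elim: j => // j IH; rewrite ltnS leq_eqVlt => /orP[/eqP -> //|/IH].
  by move=> /ltn_trans; apply.
- by move=> i; have [l [-> _]] := sE i; case: (HF (l, i)).
apply/cvgrPdist_le => e e0; near=> i.
have [l [-> _]] := sE i; have [_ _ /= h] := HF (l, i).
rewrite (le_trans h) // -[e]invrK lef_pV2 ?posrE ?invr_gt0 ?ltr0n //.
rewrite -natr1 ler_wpDr //; near: i; exact: nbhs_infty_ger.
Unshelve. all: end_near. Qed.

(** A probability within 1/8 of 1/2 is at least 3/8 away from its limit 0 or 1, and such sentences
    occur at arbitrarily large n. *)
Lemma dev_not_cvg0 (c : R) : 6 <= c -> ~ (dev (g c n) n @[n --> \oo] --> (0 : R)).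
Proof.
have e0 : 0 < 8^-1 :> R by rewrite invr_gt0 ltr0n.
have half : 0 <= (2^-1 : R) <= 1 by apply/andP; split; lra.
move=> c6 /cvgr0Pnorm_le/(_ _ e0)[M _ HM].
have [[n Phi] /= [Mn dn hn]] := prob_interpolation M c6 half e0.
have := HM n (ltnW Mn); have := dev_ge n dn.
have [v [-> _]] := @zero_one_law R Phi (qdepth Phi) (leqnSn _).
move=> h1 h2; have {h1 h2} := le_trans (le_trans h1 (ler_norm _)) h2.
move: hn; rewrite !ler_norml => /andP[a1 a2].
by case: v => /= /andP[]; lra.
Qed.

End Interpolation.

Theorem theorem6p10 (R : realType) (c : R) :
  (c < 1 -> dev (g c n) n @[n --> \oo] --> (0 : R)) /\
  (6 < c ->
     ~ (dev (g c n) n @[n --> \oo] --> (0 : R)) /\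
     (forall gamma : R, 0 <= gamma <= 1 ->
        exists (N : nat -> nat) (Phi : nat -> sentence),
          [/\ (forall i, (1 < N i)%N),
              (forall i j, (i < j)%N -> (N i < N j)%N),
              (forall i, (qdepth (Phi i))%:R <= g c (N i)) &
              prob R (N i) (Phi i) @[i --> \oo] --> gamma])).
Proof.
split=> [|/ltW c6]; first exact: dev_cvg0.
by split=> [|gamma]; [exact: dev_not_cvg0 | exact: prob_sequence].
Qed.
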